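(* For every map $\varphi\colon\mathbb{R}_+\to\mathbb{R}_+$ satisfying $\varphi(t)=o\left(t^{1/3}\right)$ as $t\to+\infty$, and for every nonempty open subset $\mathcal{V}$ of $\mathbb{R}$, the set of irrational numbers $\theta\in\mathcal{V}$ whose associated irrational rotation $R_\theta$ is $\varphi$-integrably orbit equivalent to the universal odometer is uncountable.
   Context: For irrational $\theta$, $R_\theta\colon z\mapsto e^{2i\pi\theta}z$ is the irrational rotation on the unit circle with its Haar probability measure. All probability spaces are standard and atomless; $\mathrm{Aut}(X,\mu)$ is the set of bimeasurable bijections of $X$ preserving the probability measure $\mu$, two such maps being identified if they coincide almost everywhere. **Orbit equivalence.** Aperiodic $S\in\mathrm{Aut}(X,\mu)$ and $T\in\mathrm{Aut}(Y,\nu)$ are orbit equivalent if there is a bimeasurable bijection $\Psi\colon X\to Y$ with $\Psi_\star\mu=\nu$ such that $S$ and $\Psi^{-1}T\Psi$ have the same orbits at almost every point. The associated cocycles $c_S\colon X\to\mathbb{Z}$, $c_T\colon Y\to\mathbb{Z}$ are defined almost everywhere by $Sx=\Psi^{-1}T^{c_S(x)}\Psi(x)$ and $Ty=\Psi S^{c_T(y)}\Psi^{-1}(y)$. $S$ and $T$ are $\varphi$-integrably orbit equivalent if some orbit equivalence $\Psi$ satisfies $\int_X\varphi(|c_S|)\,d\mu<+\infty$ and $\int_Y\varphi(|c_T|)\,d\nu<+\infty$. **Universal odometer.** For integers $q_n\ge 2$, the odometer on $\prod_{n\ge0}\{0,\dots,q_n-1\}$ (with the product of the uniform probability measures) is the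 addition of $(1,0,0,\dots)$ with carry over to the right. It is universal if every prime number has infinite multiplicity as a prime factor among the $q_n$, $n\ge0$. The universal odometer is unique up to conjugacy. *)

(* Defs.v *)
From HB Require Import structures.
From mathcomp Require Import all_boot all_order all_algebra archimedean.
From mathcomp Require Import complex zify.
From mathcomp Require Import all_classical all_reals all_analysis.
From mathcomp Require Import measurable_realfun.

Set Implicit Arguments.
Unset Strict Implicit.
Unset Printing Implicit Defensive.

Import Order.TTheory GRing.Theory Num.Theory.
Import numFieldNormedType.Exports.

Local Open Scope classical_set_scope.
Local Open Scope ring_scope.

Section MeasurePreserving.
Context d d' (X : measurableType d) (Y : measurableType d') (R : realType).

(* Bimeasurable bijections are defined everywhere; only equations between
   dynamical systems are taken almost everywhere. *)
Record mp_iso (mu : probability X R) (nu : probability Y R) := MPIso {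
  mp_fun :> X -> Y;
  mp_inv : Y -> X;
  mp_funK : cancel mp_fun mp_inv;
  mp_invK : cancel mp_inv mp_fun;
  measurable_mp_fun : measurable_fun [set: X] mp_fun;
  measurable_mp_inv : measurable_fun [set: Y] mp_inv;
  mp_push : forall A, measurable A -> pushforward mu mp_fun A = nu A }.

End MeasurePreserving.

Definition aut d (X : measurableType d) (R : realType) (mu : probability X R) :=
  mp_iso mu mu.

Definition aut_iter d (X : measurableType d) (R : realType)
    (mu : probability X R) (T : aut mu) (k : int) : X -> X :=
  match k with
  | Posz n => iter n T
  | Negz n => iter n.+1 (mp_inv T)
  end.

Definition aperiodic d (X : measurableType d) (R : realType)
    (mu : probability X R) (T : aut mu) : Prop :=
  {ae mu, forall x, forall k : int, k != 0 -> aut_iter T k x <> x}.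

Section OrbitEquivalence.
Context d d' (X : measurableType d) (Y : measurableType d') (R : realType).
Variables (mu : probability X R) (nu : probability Y R).
Variables (S : aut mu) (T : aut nu).

(* [mp_inv Psi (aut_iter T k (Psi x))] is the image of [x] under the [k]-th
   iterate of [Psi^-1 T Psi] *)
Definition orbit_equivalence (Psi : mp_iso mu nu) : Prop :=
  {ae mu, forall x,
    range (fun k : int => aut_iter S k x) =
    range (fun k : int => mp_inv Psi (aut_iter T k (Psi x)))}.

(* The cocycles c_S and c_T. For an orbit equivalence between aperiodic maps,
   exactly one integer satisfies the defining relation at almost every point;
   the default value 0 is only taken where there is none. *)
Definition cocycle_source (Psi : mp_iso mu nu) (x : X) : int :=
  xget 0 [set k : int | S x = mp_inv Psi (aut_iter T k (Psi x))].

Definition cocycle_target (Psi : mp_iso mu nu) (y : Y) : int :=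
  xget 0 [set k : int | T y = Psi (aut_iter S k (mp_inv Psi y))].

Definition integrably_orbit_equivalent (phi : R -> R) : Prop :=
  [/\ aperiodic S, aperiodic T &
    exists Psi : mp_iso mu nu,
    [/\ orbit_equivalence Psi,
        (\int[mu]_x (phi `|cocycle_source Psi x|%:~R)%:E < +oo)%E &
        (\int[nu]_y (phi `|cocycle_target Psi y|%:~R)%:E < +oo)%E]].

End OrbitEquivalence.

Record circle (R : realType) := Circle {
  circle_val :> R[i];
  circle_norm : `|circle_val| == 1 }.

HB.instance Definition _ (R : realType) := [isSub for @circle_val R].
HB.instance Definition _ (R : realType) := [Choice of circle R by <:].

Definition circle1 (R : realType) : circle R := Circle (introT eqP (normr1 R[i])).
HB.instance Definition _ (R : realType) := isPointed.Build (circle R) (circle1 R).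

(* The measurable sets of the circle are the preimages of the Borel sets of the
   plane under [circle_coord]. *)
Definition circle_coord (R : realType) (z : circle R) : R * R :=
  (complex.Re (z : R[i]), complex.Im (z : R[i])).

HB.instance Definition _ (R : realType) := Measurable.copy (circle R)
  (g_sigma_algebra_preimageType (@circle_coord R)).

Lemma expi_norm (R : realType) (t : R) :
  `|(cos (2 * pi * t) +i* sin (2 * pi * t))%C| == 1 :> R[i].
Proof. by rewrite normc_def /= cos2Dsin2 sqrtr1. Qed.

(* e^(2 i pi t) *)
Definition expi (R : realType) (t : R) : circle R := Circle (expi_norm t).

Lemma circle_mul_norm (R : realType) (z w : circle R) :
  `|(z : R[i]) * (w : R[i])| == 1.
Proof. by rewrite normrM (eqP (circle_norm z)) (eqP (circle_norm w)) mulr1. Qed.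

Definition circle_mul (R : realType) (z w : circle R) : circle R :=
  Circle (circle_mul_norm z w).

Section CircleTheory.
Variable R : realType.
Implicit Types (z w : circle R) (s t : R).

Lemma circle_eqP z w :
  complex.Re (z : R[i]) = complex.Re (w : R[i]) ->
  complex.Im (z : R[i]) = complex.Im (w : R[i]) -> z = w.
Proof.
move=> re im; apply: val_inj => /=.
by move: re im; case: (circle_val z) => a b; case: (circle_val w) => c d /= -> ->.
Qed.

Lemma expiD s t : expi (s + t) = circle_mul (expi s) (expi t).
Proof.
apply: circle_eqP => /=; first by rewrite mulrDr cosD.
by rewrite mulrDr sinD addrC [cos _ * _]mulrC.
Qed.

Lemma expi0 : expi (0 : R) = circle1 R.
Proof. by apply: circle_eqP; rewrite /= mulr0 ?cos0 ?sin0. Qed.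

Lemma circle_mulA : associative (@circle_mul R).
Proof. by move=> u v w; apply: val_inj => /=; rewrite mulrA. Qed.

Lemma circle_mul1 : left_id (circle1 R) (@circle_mul R).
Proof. by move=> u; apply: val_inj => /=; rewrite mul1r. Qed.

Lemma circle_mulC : commutative (@circle_mul R).
Proof. by move=> u v; apply: val_inj => /=; rewrite mulrC. Qed.

Lemma expi_nat t n : expi (t + n%:R) = expi t.
Proof.
have E : 2 * pi * (t + n%:R) = 2 * pi * t + (pi *+ 2) *+ n :> R.
  by rewrite mulrDr -(mulr_natl pi 2) -[in RHS](mulr_natr (2 * pi) n).
apply: circle_eqP => /=; rewrite E.
  by rewrite (periodicn (@cosD2pi R)).
by rewrite (periodicn (@sinD2pi R)).
Qed.

Lemma expi_int t (k : int) : expi (t + k%:~R) = expi t.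
Proof.
case: k => n; first by rewrite expi_nat.
by rewrite NegzE mulrNz -[LHS](expi_nat _ n.+1) subrK.
Qed.

Lemma measurable_circle_coord : measurable_fun [set: circle R] (@circle_coord R).
Proof. by move=> _ A mA; exists A. Qed.

Lemma measurable_to_circle d (T : measurableType d) (f : T -> circle R) :
  measurable_fun [set: T] (fun x => complex.Re (f x : R[i])) ->
  measurable_fun [set: T] (fun x => complex.Im (f x : R[i])) ->
  measurable_fun [set: T] f.
Proof.
move=> mre mim mT _ [B mB <-]; rewrite !setTI.
have -> : f @^-1` (@circle_coord R @^-1` B) =
    [set: T] `&` (fun x => circle_coord (f x)) @^-1` B by rewrite setTI.
by apply: (measurable_fun_pairP _).2.
Qed.

Lemma measurable_circle_Re :
  measurable_fun [set: circle R] (fun z => complex.Re (z : R[i])).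
Proof. by have [] := (measurable_fun_pairP _).1 measurable_circle_coord. Qed.

Lemma measurable_circle_Im :
  measurable_fun [set: circle R] (fun z => complex.Im (z : R[i])).
Proof. by have [] := (measurable_fun_pairP _).1 measurable_circle_coord. Qed.

Lemma measurable_expi :
  @measurable_fun _ _ (measurableTypeR R) (circle R) [set: R] (@expi R).
Proof.
apply: measurable_to_circle => /=.
  apply: measurableT_comp; first by apply: continuous_measurable_fun; exact: continuous_cos.
  by apply: measurable_funM => //.
apply: measurableT_comp; first by apply: continuous_measurable_fun; exact: continuous_sin.
by apply: measurable_funM => //.
Qed.

Lemma measurable_circle_mul u : measurable_fun [set: circle R] (circle_mul u).
Proof.
have mR := measurable_circle_Re; have mI := measurable_circle_Im.
apply: measurable_to_circle; case: u => -[a b] abP.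
  apply: (@eq_measurable_fun _ _ _ _ _ (fun z : circle R =>
    a * complex.Re (z : R[i]) - b * complex.Im (z : R[i]))).
    by move=> [[c d] cd] _.
  by apply: measurable_funB; apply: measurable_funM => //.
apply: (@eq_measurable_fun _ _ _ _ _ (fun z : circle R =>
  a * complex.Im (z : R[i]) + b * complex.Re (z : R[i]))).
  by move=> [[c d] cd] _.
by apply: measurable_funD; apply: measurable_funM => //.
Qed.

HB.instance Definition _ :=
  isMeasurableFun.Build _ _ (measurableTypeR R) (circle R)
    (@expi R : measurableTypeR R -> circle R) measurable_expi.

(* The image of the uniform law on [0, 1] under [expi]; it is invariant
   under every rotation by [haar_invariant], hence the Haar probability measure. *)
Definition haar : probability (circle R) R :=
  distribution (uniform_prob (@ltr01 R))
    (@expi R : {mfun measurableTypeR R >-> circle R}).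

Local Notation leb := (@lebesgue_measure R).

Lemma lebesgue_measure_shift (c : R) (A : set R) : measurable A ->
  leb [set t | A (t + c)] = leb A.
Proof.
move=> mA.
have mf : measurable_fun [set: measurableTypeR R] ((fun t => t + c) : _ -> measurableTypeR R).
  by apply: measurable_funD => //.
pose m0 : {measure set (measurableTypeR R) -> \bar R} :=
  pushforward leb ((fun t => t + c) : _ -> measurableTypeR R).
pose m := m0 mf.
suff H X : ocitv X -> leb X = m X.
  exact/esym/(lebesgue_measure_unique H mA).
move=> [[a b] _ <-].
rewrite /m /m0 /= /pushforward.
rewrite (_ : _ @^-1` _ = `](a - c), (b - c)]%classic); last first.
  by apply/seteqP; split=> t /=; rewrite !in_itv/= ltrBlDr lerBrDr.
rewrite !lebesgue_measure_itv/= !lte_fin ltrD2r; case: ifP => // _.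
by rewrite -!EFinB; congr (_%:E); rewrite opprB addrA subrK.
Qed.

Lemma uniform_probE (A : set R) : measurable A ->
  uniform_prob (@ltr01 R) A = leb (A `&` `[0, 1[).
Proof.
move=> mA; rewrite /uniform_prob integral_uniform_pdf.
rewrite (eq_integral (fun=> 1%:E)); last first.
  by move=> x; rewrite inE/= in_itv/= /uniform_pdf => -[_ ->]; rewrite subr0 invr1.
rewrite integral_cst/=; last by apply: measurableI.
rewrite mul1e.
have -> : A `&` `[0, 1] = (A `&` `[0, 1[) `|` (A `&` [set 1]).
  rewrite -setIUr; congr (A `&` _); apply/seteqP; split=> t /=; rewrite !in_itv/=.
    by case/andP=> -> /=; rewrite le_eqVlt => /orP[/eqP ->|->]; [right|left].
  by case=> [/andP[-> /ltW]//|->]; rewrite ler01 lexx.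
rewrite measureU//; [|exact: measurableI|exact: measurableI|].
- rewrite [X in (_ + X)%E](_ : _ = 0%E) ?adde0//.
  apply: (@subset_measure0 _ _ _ leb _ [set 1]) => //; [exact: measurableI|].
  exact: lebesgue_measure_set1.
- rewrite -subset0 => x [[_]] /=; rewrite in_itv/= => /andP[_ x1] [_ x1E].
  by rewrite x1E ltxx in x1.
Qed.

Lemma periodic_shift (B : set R) (c : R) : measurable B ->
  (forall t (k : int), B (t + k%:~R) <-> B t) ->
  leb ([set t | B (t + c)] `&` `[0, 1[) = leb (B `&` `[0, 1[).
Proof.
move=> mB pB.
wlog c01 : c / 0 <= c < 1 => [wh|].
  pose r := c - (Num.floor c)%:~R.
  rewrite -(wh r); last by rewrite /r subr_ge0 ltrBlDl ge_floor/= -[1]/(1%:~R) -intrD floorD1_gt.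
  congr (leb (_ `&` _)); apply/seteqP; split => t /=.
    by move=> Bt; apply/(pB _ (Num.floor c)); rewrite /r addrA subrK.
  by move=> /(pB _ (Num.floor c)); rewrite /r addrA subrK.
case/andP: c01 => c0 c1.
have -> : [set t | B (t + c)] `&` `[0, 1[ =
    [set t | (B `&` `[c, (1 + c)[) (t + c)].
  by apply/seteqP; split=> t /=; rewrite !in_itv/= lerDr ltrD2r.
rewrite lebesgue_measure_shift; last exact: measurableI.
have m1 : measurable (B `&` `[c, 1[) by exact: measurableI.
have -> : B `&` `[c, (1 + c)[ = (B `&` `[c, 1[) `|` (B `&` `[1, (1 + c)[).
  rewrite -setIUr; congr (B `&` _); apply/seteqP; split => t /=; rewrite !in_itv/=.
    by case/andP=> ct tc; case: (ltP t 1) => t1; [left|right]; rewrite ?ct.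
  case=> /andP[a b]; first by rewrite a (lt_le_trans b)// lerDl.
  by rewrite b (le_trans _ a)// ltW.
have -> : B `&` `[0, 1[ = (B `&` `[c, 1[) `|` (B `&` `[0, c[).
  rewrite -setIUr; congr (B `&` _); apply/seteqP; split => t /=; rewrite !in_itv/=.
    by case/andP=> ct tc; case: (ltP t c) => t1; [right|left]; rewrite ?ct.
  case=> /andP[a b]; first by rewrite b (le_trans c0 a).
  by rewrite a (lt_trans b c1).
rewrite !measureU//; try exact: measurableI.
- congr (_ + _)%E.
  have mB1 : measurable (B `&` `[1, (1 + c)[) by exact: measurableI.
  apply: (etrans (esym (lebesgue_measure_shift 1 mB1))).
  congr (leb _); apply/seteqP; split=> t /=; rewrite !in_itv/= lerDr [t + 1]addrC ltrD2l addrC.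
    by case=> /(pB _ 1).
  by case=> Bt t0; split=> //; apply/(pB _ 1).
- rewrite -subset0 => x [[_ /=]]; rewrite in_itv/= => /andP[a _] [_].
  by rewrite /= in_itv/= ltNge a andbF.
- rewrite -subset0 => x [[_ /=]]; rewrite in_itv/= => /andP[_ a] [_].
  by rewrite /= in_itv/= leNgt a.
Qed.

Lemma haar_invariant (t : R) (A : set (circle R)) : measurable A ->
  pushforward haar (circle_mul (expi t)) A = haar A.
Proof.
move=> mA; rewrite /pushforward /= /distribution /pushforward.
have mE B : measurable B -> measurable ((@expi R) @^-1` B).
  by move=> mB; rewrite -[X in measurable X]setTI; exact: measurable_expi.
rewrite !uniform_probE; last 2 first.
- exact: mE.
- by apply: mE; rewrite -[X in measurable X]setTI; exact: measurable_circle_mul.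
rewrite -(@periodic_shift ((@expi R) @^-1` A) t); last 2 first.
- exact: mE.
- by move=> s k /=; rewrite expi_int.
congr (leb (_ `&` _)); apply/seteqP; split=> s /=; by rewrite addrC expiD.
Qed.

Lemma rotationK (theta : R) :
  cancel (circle_mul (expi theta)) (circle_mul (expi (- theta))).
Proof. by move=> z; rewrite circle_mulA -expiD addNr expi0 circle_mul1. Qed.

Lemma rotationVK (theta : R) :
  cancel (circle_mul (expi (- theta))) (circle_mul (expi theta)).
Proof. by move=> z; rewrite circle_mulA -expiD subrr expi0 circle_mul1. Qed.

(* z |-> e^(2 i pi theta) z *)
Definition rotation (theta : R) : aut haar :=
  MPIso (rotationK theta) (rotationVK theta)
    (measurable_circle_mul _) (measurable_circle_mul _)
    (haar_invariant theta).

End CircleTheory.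

(* The product of the {0, ..., q n - 1}, with the product sigma-algebra. *)
Definition odo_space (q : nat -> nat) (q_ge2 : forall n, (2 <= q n)%N) : Type :=
  forall n, 'I_(q n).

Section OdometerSpace.
Variables (q : nat -> nat) (q_ge2 : forall n, (2 <= q n)%N).
Local Notation X := (odo_space q_ge2).

Lemma radix_gt0 n : (0 < q n)%N.
Proof. exact: leq_trans (q_ge2 n). Qed.

HB.instance Definition _ := gen_eqMixin X.
HB.instance Definition _ := gen_choiceMixin X.
HB.instance Definition _ :=
  isPointed.Build X (fun n => Ordinal (radix_gt0 n)).

Definition coordinate_sets : set (set X) :=
  [set A | exists n (k : 'I_(q n)), A = [set x : X | x n = k]].

HB.instance Definition _ :=
  Measurable.copy X (g_sigma_algebraType coordinate_sets).

(* the carry received by coordinate [n] when [x] and [y] are added *)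
Fixpoint carry (x y : X) (n : nat) : nat :=
  if n is m.+1 then ((x m + y m + carry x y m) %/ q m)%N else 0%N.

Definition odo_add (x y : X) : X :=
  fun n => Ordinal (ltn_pmod (x n + y n + carry x y n) (radix_gt0 n)).

Lemma odo_one_subproof n : ((n == 0) < q n)%N.
Proof. by apply: leq_trans (q_ge2 n); case: eqP. Qed.

Definition odo_one : X := fun n => Ordinal (odo_one_subproof n).

Lemma odo_max_subproof n : ((q n).-1 < q n)%N.
Proof. by rewrite prednK // radix_gt0. Qed.

(* the additive inverse of [odo_one] *)
Definition odo_max : X := fun n => Ordinal (odo_max_subproof n).

Definition odo_succ (x : X) : X := odo_add x odo_one.

Definition odo_pred (x : X) : X := odo_add x odo_max.

Lemma odo_eqP (x y : X) : (forall n, x n = y n :> nat) -> x = y.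
Proof. by move=> xy; apply: functional_extensionality_dep => n; apply: val_inj; exact: xy. Qed.

Lemma divn_bit a b : (a < b.*2)%N -> (a %/ b = (b <= a))%N.
Proof.
move=> ab; case: leqP => [ba|]; last exact: divn_small.
have b0 : (0 < b)%N by case: b ab {ba} => //; rewrite ltn0.
apply/eqP; rewrite eqn_leq -ltnS ltn_divLR // leq_divRL // mul1n ba andbT.
by rewrite mulSn mul1n addnn.
Qed.

Lemma modn_bit a b : (a < b.*2)%N -> (a %% b = if b <= a then a - b else a)%N.
Proof.
move=> ab; case: leqP => [ba|]; last exact: modn_small.
by rewrite -[in LHS](subnK ba) modnDr modn_small // ltn_subLR // addnn.
Qed.

Lemma carry_succ_pred (x : X) n :
  (carry x odo_one n + carry (odo_succ x) odo_max n + (n == 0) = 1)%N.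
Proof.
elim: n => [//|n]; rewrite /=.
have := ltn_ord (x n); have := q_ge2 n.
move: (carry x odo_one n) (carry (odo_succ x) _ n) (q n) (nat_of_ord (x n)) (n == 0 : nat).
move=> c d b a e b2 ab cde.
have h1 : (a + e + c < b.*2)%N by lia.
rewrite (divn_bit h1) (modn_bit h1); case: (leqP b) => h2 /=; rewrite divn_bit; lia.
Qed.

Lemma carry_pred_succ (x : X) n :
  (carry x odo_max n + carry (odo_pred x) odo_one n + (n == 0) = 1)%N.
Proof.
elim: n => [//|n]; rewrite /=.
have := ltn_ord (x n); have := q_ge2 n.
move: (carry x odo_max n) (carry (odo_pred x) _ n) (q n) (nat_of_ord (x n)) (n == 0 : nat).
move=> c d b a e b2 ab cde.
have h1 : (a + b.-1 + c < b.*2)%N by lia.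
rewrite (divn_bit h1) (modn_bit h1); case: (leqP b) => h2 /=; rewrite divn_bit; lia.
Qed.

Lemma odo_succK : cancel odo_succ odo_pred.
Proof.
move=> x; apply: odo_eqP => n /=; have := carry_succ_pred x n.
have := ltn_ord (x n); have := q_ge2 n.
move: (carry x odo_one n) (carry (odo_succ x) _ n) (q n) (nat_of_ord (x n)) (n == 0 : nat).
move=> c d b a e b2 ab cde.
have h1 : (a + e + c < b.*2)%N by lia.
by rewrite (modn_bit h1); case: ifP => h2; rewrite modn_bit; try case: ifP; lia.
Qed.

Lemma odo_predK : cancel odo_pred odo_succ.
Proof.
move=> x; apply: odo_eqP => n /=; have := carry_pred_succ x n.
have := ltn_ord (x n); have := q_ge2 n.
move: (carry x odo_max n) (carry (odo_pred x) _ n) (q n) (nat_of_ord (x n)) (n == 0 : nat).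
move=> c d b a e b2 ab cde.
have h1 : (a + b.-1 + c < b.*2)%N by lia.
by rewrite (modn_bit h1); case: ifP => h2; rewrite modn_bit; try case: ifP; lia.
Qed.

Definition cylinder (n : nat) (a : X) : set X :=
  [set x | forall i, (i < n)%N -> x i = a i].

Lemma carry_local (y x x' : X) n : cylinder n x' x -> carry x y n = carry x' y n.
Proof.
elim: n => [//|n IH] xx' /=; rewrite xx'// IH// => i ilt; apply: xx'.
exact: ltnW.
Qed.

Lemma odo_add_local (y x x' : X) n :
  cylinder n x' x -> cylinder n (odo_add x' y) (odo_add x y).
Proof.
move=> xx' i ilt; apply: val_inj => /=; rewrite xx'// (@carry_local _ _ x')//.
by move=> j jlt; apply: xx'; exact: ltn_trans ilt.
Qed.

Lemma measurable_coordinate n (k : 'I_(q n)) : measurable [set x : X | x n = k].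
Proof. by apply: sub_sigma_algebra; exists n, k. Qed.

Lemma measurable_cylinder n a : measurable (cylinder n a).
Proof.
rewrite (_ : cylinder n a =
    \bigcap_(i in [set i | (i < n)%N]) [set x : X | x i = a i]).
  by apply: bigcap_measurableType => i _; exact: measurable_coordinate.
by apply/seteqP; split => x /= h i; exact: h.
Qed.

(* a cylinder only depends on a finite word *)
Definition word_point (s : seq nat) : X :=
  fun n => Ordinal (ltn_pmod (nth 0%N s n) (radix_gt0 n)).

Lemma measurable_local n (A : set X) :
  (forall x y, cylinder n x y -> A x -> A y) -> measurable A.
Proof.
move=> Aloc.
pose F (s : seq nat) := if `[< A (word_point s) >] then cylinder n (word_point s) else set0.
rewrite (_ : A = \bigcup_s F s).
  apply: countable_bigcupT_measurable => [|s]; first exact: countableP.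
  by rewrite /F; case: ifP => _ //; exact: measurable_cylinder.
apply/seteqP; split => [x Ax|x [s _]]; rewrite /F.
  have wx : cylinder n x (word_point (mkseq (fun i => nat_of_ord (x i)) n)).
    by move=> i ilt; apply: val_inj => /=; rewrite nth_mkseq// modn_small.
  exists (mkseq (fun i => nat_of_ord (x i)) n) => //.
  rewrite asboolT; last exact: Aloc wx Ax.
  by move=> i ilt; rewrite wx.
by case: asboolP => // As xs; apply: Aloc As.
Qed.

Lemma measurable_to_odo d (T : measurableType d) (f : T -> X) :
  (forall n (k : 'I_(q n)), measurable [set t | f t n = k]) ->
  measurable_fun [set: T] f.
Proof.
move=> mf; apply: (@measurability _ _ T X setT f coordinate_sets) => //.
by move=> _ [_ [n [k ->]] <-]; rewrite setTI; exact: mf.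
Qed.

Lemma measurable_odo_add y : measurable_fun [set: X] (fun x : X => odo_add x y).
Proof.
apply: measurable_to_odo => n k; apply: (@measurable_local n.+1) => x x' xx'; rewrite /mkset => <-.
exact: (odo_add_local y xx' (ltnSn n)).
Qed.

Definition cylinders : set (set X) :=
  [set A | A = set0 \/ exists n a, A = cylinder n a].

Lemma cylinders_setI : setI_closed cylinders.
Proof.
have sub n m a b : (n <= m)%N ->
    cylinder n a `&` cylinder m b = set0 \/
    cylinder n a `&` cylinder m b = cylinder m b.
  move=> nm; have [ab|nab] := pselect (cylinder n a b); [right|left].
    apply/seteqP; split=> [x []//|x xb]; split=> // i ilt.
    by rewrite xb ?ab//; exact: leq_trans nm.
  rewrite -subset0 => x [xa xb]; apply: nab => i ilt; rewrite -xa// xb//.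
  exact: leq_trans nm.
move=> _ _ [->|[n [a ->]]] [->|[m [b ->]]]; rewrite ?set0I ?setI0; try by left.
case: (leqP n m) => nm.
  by have [->|->] := sub _ _ a b nm; [left|right; exists m, b].
rewrite setIC; have [->|->] := sub _ _ b a (ltnW nm); [by left|].
by right; exists n, a.
Qed.

Lemma measurable_cylinders : @measurable _ X = <<s cylinders >>.
Proof.
apply/seteqP; split; last first.
  apply: smallest_sub; first exact: sigma_algebra_measurable.
  by move=> _ [->|[n [a ->]]]; [exact: measurable0|exact: measurable_cylinder].
apply: smallest_sub; first exact: smallest_sigma_algebra.
move=> _ [n [k ->]].
pose F (s : seq nat) := if word_point s n == k then cylinder n.+1 (word_point s) else set0.
rewrite (_ : [set x : X | x n = k] = \bigcup_s F s).
  apply: (@countable_bigcupT_measurable _ (g_sigma_algebraType cylinders)) => [|s].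
    exact: countableP.
  apply: sub_sigma_algebra; rewrite /F; case: ifP => _; [right|by left].
  by exists n.+1, (word_point s).
apply/seteqP; split => [x xk|x [s _]]; rewrite /F.
  have wx : cylinder n.+1 x (word_point (mkseq (fun i => nat_of_ord (x i)) n.+1)).
    by move=> i ilt; apply: val_inj => /=; rewrite nth_mkseq// modn_small.
  exists (mkseq (fun i => nat_of_ord (x i)) n.+1) => //.
  by rewrite wx// xk eqxx => i ilt; rewrite wx.
by case: eqP => // sk xs; rewrite /= xs.
Qed.

End OdometerSpace.

Section OdometerMeasure.
Variables (R : realType) (q : nat -> nat) (q_ge2 : forall n, (2 <= q n)%N).
Local Notation X := (odo_space q_ge2).
Local Notation q_gt0 := (radix_gt0 q_ge2).

Definition radix_prod n := (\prod_(i < n) q i)%N.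

(* For 0 <= t < 1, the digits of t = sum_n (digits t n) / (q 0 * ... * q n). *)
Definition digits (t : R) : X := fun n =>
  Ordinal (ltn_pmod (Num.truncn (t * (radix_prod n.+1)%:R)) (q_gt0 n)).

Lemma radix_prodS n : radix_prod n.+1 = (radix_prod n * q n)%N.
Proof. by rewrite /radix_prod big_ord_recr. Qed.

Lemma radix_prod_gt0 n : (0 < radix_prod n)%N.
Proof. by rewrite prodn_gt0// => i; exact: q_gt0. Qed.

Lemma measurable_truncn m :
  measurable [set t : measurableTypeR R | Num.truncn t = m].
Proof.
rewrite (_ : mkset _ = [set` if m is m'.+1 then `[m%:R, m.+1%:R[ else `]-oo, 1[ : interval R]).
  by case: m => [|m]; exact: measurable_itv.
apply/seteqP; split => t /=.
  case: m => [|m]; rewrite in_itv/=.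
    by move=> t0; have := @truncn_gt0 R t; rewrite t0 ltnn => /esym/negbT; rewrite -ltNge.
  move=> tm; have t1 : 1 <= t by rewrite -truncn_gt0 tm.
  by have := truncn_itv (le_trans ler01 t1); rewrite tm.
case: m => [|m]; rewrite in_itv/=.
  by move=> t1; apply/truncn0Pn; rewrite -ltNge.
exact: truncn_def.
Qed.

Lemma measurable_digits : @measurable_fun _ _ (measurableTypeR R) X setT digits.
Proof.
apply: measurable_to_odo => n k.
rewrite (_ : mkset _ = \bigcup_(m in [set m | (m %% q n)%N = k])
   ((fun t : measurableTypeR R => t * (radix_prod n.+1)%:R) @^-1`
     [set t : measurableTypeR R | Num.truncn t = m])).
  apply: bigcup_measurable => m _.
  rewrite -[X in measurable X]setTI.
  have mf : @measurable_fun _ _ (measurableTypeR R) (measurableTypeR R) setT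
      (fun t => t * (radix_prod n.+1)%:R) by apply: measurable_funM.
  by apply: mf => //; exact: measurable_truncn.
apply/seteqP; split => t /=.
  by move=> tk; exists (Num.truncn (t * (radix_prod n.+1)%:R)) => //=; rewrite -tk.
by case=> m mk tm; apply: val_inj => /=; rewrite tm.
Qed.

HB.instance Definition _ :=
  isMeasurableFun.Build _ _ (measurableTypeR R) X
    (digits : measurableTypeR R -> X) measurable_digits.

(* The product of the uniform probability measures, obtained as the law of the
   digits of a uniform number in [0, 1]; it is characterized by its values on
   cylinders, given by [odo_prob_cylinder]. *)
Definition odo_prob : probability X R :=
  distribution (uniform_prob (@ltr01 R))
    (digits : {mfun measurableTypeR R >-> X}).

Fixpoint prefix_value (a : X) n : nat :=
  if n is m.+1 then (prefix_value a m * q m + a m)%N else 0%N.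

Lemma prefix_value_lt a n : (prefix_value a n < radix_prod n)%N.
Proof.
elim: n => [|n IH] /=; first by rewrite /radix_prod big_ord0.
rewrite radix_prodS.
by have := ltn_ord (a n); move: IH; nia.
Qed.

Lemma prefix_value_inj a b n :
  prefix_value a n = prefix_value b n -> cylinder n a b.
Proof.
elim: n => [_ i //|n IH] /= e.
have e1 : prefix_value a n = prefix_value b n.
  have := congr1 (fun m => m %/ q n)%N e.
  by rewrite !divnMDl ?q_gt0// !divn_small// !addn0.
have e2 : a n = b n.
  by apply: val_inj; move: e; rewrite e1 => /addnI.
move=> i; rewrite ltnS leq_eqVlt => /orP[/eqP ->//|ilt].
exact: IH.
Qed.

Lemma prefix_value_local a b n :
  cylinder n a b -> prefix_value b n = prefix_value a n.
Proof.
elim: n => [//|n IH] h /=; rewrite h// IH// => i ilt; apply: h.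
exact: ltnW.
Qed.

Lemma truncn_divn (y : R) (m : nat) : 0 <= y -> (0 < m)%N ->
  (Num.truncn (y * m%:R) %/ m)%N = Num.truncn y.
Proof.
move=> y0 m0; have ym : 0 <= y * m%:R by rewrite mulr_ge0.
have /andP[a b] := truncn_itv y0.
apply/eqP; rewrite eqn_leq -ltnS ltn_divLR// leq_divRL//.
rewrite truncn_lt_nat// truncn_ge_nat// !natrM.
by rewrite ltr_pM2r ?ltr0n// b ler_pM2r ?ltr0n.
Qed.

Lemma prefix_value_digits (t : R) n : 0 <= t < 1 ->
  Num.truncn (t * (radix_prod n)%:R) = prefix_value (digits t) n.
Proof.
move=> /andP[t0 t1]; elim: n => [|n IH].
  rewrite /radix_prod big_ord0 mulr1 /=.
  by apply/truncn0Pn; rewrite -ltNge.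
rewrite /= -IH [in LHS](divn_eq (Num.truncn _) (q n)); congr (_ * _ + _)%N.
by rewrite radix_prodS natrM mulrA truncn_divn// ?q_gt0// mulr_ge0.
Qed.

Lemma odo_prob_cylinder n a :
  odo_prob (cylinder n a) = ((radix_prod n)%:R^-1)%:E.
Proof.
rewrite /= /distribution /pushforward uniform_probE; last first.
  rewrite -[X in measurable X]setTI; apply: measurable_digits => //.
  exact: measurable_cylinder.
have Q0 : 0 < (radix_prod n)%:R :> R by rewrite ltr0n radix_prod_gt0.
pose K := prefix_value a n.
rewrite (_ : _ `&` _ =
    [set` `[(K%:R / (radix_prod n)%:R : R), (K.+1%:R / (radix_prod n)%:R)[]).
  rewrite lebesgue_measure_itv/= lte_fin ltr_pM2r ?invr_gt0// ltr_nat ltnSn.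
  by rewrite -EFinB -mulrBl -natrB// subSnn mul1r.
apply/seteqP; split=> t /=; rewrite !in_itv/= ler_pdivrMr// ltr_pdivlMr//.
  move=> [ta t01]; have := prefix_value_digits n t01.
  rewrite (prefix_value_local ta) -/K => <-; apply: truncn_itv.
  by case/andP: t01 => t0 _; rewrite mulr_ge0.
move=> tK; have t0 : 0 <= t.
  by case/andP: tK => + _; move=> h; rewrite -(pmulr_lge0 _ Q0); exact: le_trans h.
have t1 : t < 1.
  case/andP: tK => _ h; rewrite -(ltr_pM2r Q0) mul1r (lt_le_trans h)// ler_nat.
  exact: prefix_value_lt.
have t01 : 0 <= t < 1 by rewrite t0.
split=> //; apply: prefix_value_inj; rewrite -prefix_value_digits//.
by apply/esym/truncn_def.
Qed.

Lemma odo_succ_preserving A : measurable A ->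
  pushforward odo_prob (@odo_succ q q_ge2) A = odo_prob A.
Proof.
pose m0 : {measure set X -> \bar R} := pushforward odo_prob (@odo_succ q q_ge2).
pose m := m0 (measurable_odo_add (odo_one q_ge2)).
suff H B : cylinders B -> m B = odo_prob B.
  have cT : cylinder 0 (point : X) = setT by apply/seteqP; split.
  have cc : forall _ : nat, cylinders (cylinder 0 (point : X)).
    by move=> _; right; exists 0%N, point.
  have cU : \bigcup_(k in [set: nat]) cylinder 0 (point : X) = setT.
    by rewrite cT bigcup_const//; exists 0%N.
  have fin : forall _ : nat, (m (cylinder 0 (point : X)) < +oo)%E.
    by move=> _; rewrite cT /m /m0/= /pushforward preimage_setT probability_setT ltry.
  exact: (measure_unique _ _ (measurable_cylinders q_ge2) (@cylinders_setI q q_ge2)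
    cc cU m odo_prob H fin).
case=> [->|[n [a ->]]]; first by rewrite !measure0.
rewrite odo_prob_cylinder -(odo_prob_cylinder n (odo_pred a)).
rewrite /m /m0 /= /pushforward; congr (odo_prob _).
apply/seteqP; split=> x /= h.
  by rewrite -[x](@odo_succK q); exact: odo_add_local.
by rewrite -[a](@odo_predK q); exact: odo_add_local.
Qed.

Definition odometer : aut odo_prob :=
  MPIso (@odo_succK q q_ge2) (@odo_predK q q_ge2)
    (measurable_odo_add _) (measurable_odo_add _) odo_succ_preserving.

End OdometerMeasure.

(* p has infinite total multiplicity as a prime factor of the q i *)
Definition universal_radix (q : nat -> nat) : Prop :=
  forall p, prime p -> forall m, exists n, (m <= \sum_(i < n) logn p (q i))%N.

(* Main.v *)
(* Let theta = lim p_n / H_n with H_n = q_0 ... q_(k_n - 1), H_n^2 | H_(n+1) and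
   p_(n+1) / H_(n+1) = p_n / H_n + 1 / H_(n+1). The rotations by p_n / H_n and the
   n-th cyclic approximation of the odometer both act on H_n arcs (atoms) of equal
   length. Cutting the atoms of level n into those of level n+1, one can permute the
   pieces inside each atom so that the cyclic orders given by successive rational
   rotations agree off a small set. The composition of these permutations is an
   isomorphism psi from the circle (up to countably many points) to the odometer
   space such that, with M_n = H_(n+1) / H_n^2 and outside of a set bad_n of measure
   at most 16 / M_n, a rotation by s theta with |s| <= H_n is a power at most 2 H_n
   of the odometer, and conversely. So psi is an orbit equivalence whose cocycles
   are at most 2 H_n off bad_n, and the integrals of phi(|c|) are bounded by
   sum_n phi(2 H_(n+1)) 16 / M_n. For n and H_n fixed, 2 H_(n+1) = 2 H_n^2 M_n is
   linear in M_n, so that a fast growing M_n makes the sum converge as soon as phi is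
   sublinear. The free choice of the M_n lets theta avoid any given countable set. *)
Require Import Defs.
From mathcomp Require Import all_boot all_order all_algebra.
From mathcomp Require Import archimedean complex zify ring lra.
From mathcomp Require Import all_classical all_reals all_analysis.
From mathcomp Require Import measurable_realfun.

Set Implicit Arguments.
Unset Strict Implicit.
Unset Printing Implicit Defensive.

Import Order.TTheory GRing.Theory Num.Theory.
Import numFieldNormedType.Exports.

Local Open Scope classical_set_scope.
Local Open Scope ring_scope.

(** * Coding the atoms of the rational rotations *)

Lemma eqmodzP (a b d : int) :
  (a = b %[mod d])%Z <-> exists q, a = b + q * d.
Proof.
split=> [/eqP|[q ->]]; last by rewrite addrC modzMDl.
by rewrite eqz_mod_dvd => /dvdzP[q E]; exists q; rewrite -E addrC subrK.
Qed.

Lemma divz_modz_unique (d q r : int) : 0 <= r < d ->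
  ((q * d + r) %/ d)%Z = q /\ ((q * d + r) %% d)%Z = r.
Proof.
move=> rd; have d0 : d != 0 by lia.
by rewrite divzMDl// divz_small ?addr0 ?modzMDl ?modz_small//; lia.
Qed.

Lemma modz_itv (a d : int) : 0 < d -> 0 <= (a %% d)%Z < d.
Proof. by move=> d0; rewrite modz_ge0 ?ltz_pmod// gt_eqF. Qed.

Section Encoding.
Variables (H K M p u : nat -> int).
Hypotheses (H_gt0 : forall n, 0 < H n) (M_gt0 : forall n, 0 < M n)
  (KE : forall n, K n = H n * M n) (HS : forall n, H n.+1 = H n * K n)
  (pS : forall n, p n.+1 = p n * K n + 1)
  (puE : forall n, (u n * p n = 1 %[mod H n])%Z).

Lemma K_gt0 n : 0 < K n. Proof. by rewrite KE mulr_gt0. Qed.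

(* [u n] is the inverse of [p n] modulo [H n]: the rotation by p/H moves the atom
   0 to the atom [j] in [level n j] steps. *)
Definition level n (j : int) := ((u n * j) %% H n)%Z.

(* Column-by-column reading of a table with [H n] columns: following [x], [x + H n]
   is read next ([transpose_shift]). *)
Definition transpose n (x : int) : int := (x %% H n)%Z * M n + (x %/ H n)%Z.

Definition transpose_inv n (x : int) : int := (x %% M n)%Z * H n + (x %/ M n)%Z.

(* Under the rotation by p n.+1 / H n.+1, the position of the atom [j] inside its
   parent and the level of the parent both grow by 1, so that this difference is
   constant until the level wraps around. *)
Definition offset n (j : int) := ((j - level n (j %/ K n)%Z) %% K n)%Z.

(** The code of an atom is the residue modulo [H n] of its future image in the odometer: the parent
    atom supplies the lower digits, the transposed offset the new ones. *)
Fixpoint enc n (j : int) : int :=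
  if n is n'.+1 then enc n' (j %/ K n')%Z + H n' * transpose n' (offset n' j)
  else level 0 j.

Fixpoint dec n (v : int) : int :=
  if n is n'.+1 then
    let j := dec n' (v %% H n')%Z in
    j * K n' + ((transpose_inv n' (v %/ H n')%Z + level n' j) %% K n')%Z
  else ((p 0 * v) %% H 0)%Z.

Lemma level_itv n j : 0 <= level n j < H n. Proof. exact: modz_itv. Qed.

Lemma offset_itv n j : 0 <= offset n j < K n.
Proof. by apply: modz_itv; exact: K_gt0. Qed.

Lemma transpose_itv n x : 0 <= x < K n -> 0 <= transpose n x < K n.
Proof.
rewrite KE => /andP[x0 xK]; have /andP[a b] := modz_itv x (H_gt0 n).
have c : (x %/ H n)%Z < M n by rewrite ltz_divLR// mulrC.
have d : 0 <= (x %/ H n)%Z by rewrite divz_ge0.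
by rewrite /transpose; have := M_gt0 n; have := H_gt0 n; nia.
Qed.

Lemma transpose_invK n x : 0 <= x < K n -> transpose n (transpose_inv n x) = x.
Proof.
rewrite KE => /andP[x0 xK]; rewrite /transpose /transpose_inv.
have c : (x %/ M n)%Z < H n by rewrite ltz_divLR.
have d : 0 <= (x %/ M n)%Z by rewrite divz_ge0.
have /(divz_modz_unique (x %% M n)%Z)[-> ->] : 0 <= (x %/ M n)%Z < H n by rewrite d.
by rewrite -divz_eq.
Qed.

Lemma transposeK n x : 0 <= x < K n -> transpose_inv n (transpose n x) = x.
Proof.
rewrite KE => /andP[x0 xK]; rewrite /transpose /transpose_inv.
have c : (x %/ H n)%Z < M n by rewrite ltz_divLR// mulrC.
have d : 0 <= (x %/ H n)%Z by rewrite divz_ge0.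
have /(divz_modz_unique (x %% H n)%Z)[-> ->] : 0 <= (x %/ H n)%Z < M n by rewrite d.
by rewrite -divz_eq.
Qed.

Lemma transpose_inv_itv n x : 0 <= x < K n -> 0 <= transpose_inv n x < K n.
Proof.
rewrite KE => /andP[x0 xK]; have /andP[a b] := modz_itv x (M_gt0 n).
have c : (x %/ M n)%Z < H n by rewrite ltz_divLR.
have d : 0 <= (x %/ M n)%Z by rewrite divz_ge0.
by rewrite /transpose_inv; have := M_gt0 n; have := H_gt0 n; nia.
Qed.

Lemma transpose_shift n x w :
  transpose n (x + w * H n) = transpose n x + w.
Proof.
rewrite /transpose [x + _]addrC modzMDl divzMDl; last by rewrite gt_eqF.
by rewrite [w + _]addrC addrA.
Qed.

Lemma level_eqmod n j j' : (j = j' %[mod H n])%Z -> level n j = level n j'.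
Proof. by move=> e; rewrite /level -modzMmr e modzMmr. Qed.

Lemma level_shift n j s : level n (j + s * p n) = ((level n j + s) %% H n)%Z.
Proof.
rewrite /level modzDml; case/eqmodzP: (puE n) => q E; apply/eqmodzP.
exists (s * q); transitivity (u n * j + s * (u n * p n)); first by ring.
by rewrite E; ring.
Qed.

Lemma level_mulp n j : (p n * level n j = j %[mod H n])%Z.
Proof.
rewrite /level modzMmr mulrA -modzMml [p n * _]mulrC puE modzMml mul1r.
by [].
Qed.

Lemma level_inj n j j' : level n j = level n j' -> (j = j' %[mod H n])%Z.
Proof. by move=> e; rewrite -[LHS]level_mulp e level_mulp. Qed.

Lemma level_p n a : 0 <= a < H n -> level n (p n * a) = a.
Proof.
move=> aH; rewrite /level mulrA -modzMml puE modzMml mul1r modz_small//.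
Qed.

(** Since [p n.+1] is 1 modulo [K n], so is its inverse [u n.+1]. Levels can thus be read, modulo
    [K n], from the position of the atom inside its parent. *)
Lemma levelS_mod n j : (level n.+1 j = j %[mod K n])%Z.
Proof.
have up : (u n.+1 = 1 %[mod K n])%Z.
  have /eqmodzP[q E] := puE n.+1; apply/eqmodzP.
  exists (q * H n - u n.+1 * p n).
  by move: E; rewrite pS HS; lia.
rewrite /level; have /eqmodzP[q ->] : (((u n.+1 * j) %% H n.+1)%Z = u n.+1 * j %[mod H n.+1])%Z.
  by rewrite modz_mod.
rewrite HS mulrA addrC modzMDl -modzMml up modzMml mul1r.
by [].
Qed.

Lemma divz_eqmod n j j' : (j = j' %[mod H n.+1])%Z ->
  ((j %/ K n)%Z = (j' %/ K n)%Z %[mod H n])%Z.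
Proof.
have K0 : K n != 0 by rewrite gt_eqF// K_gt0.
move=> /eqmodzP[q ->]; rewrite HS mulrA addrC divzMDl// addrC.
by apply/eqmodzP; exists q.
Qed.

Lemma offset_eqmod n j j' : (j = j' %[mod H n.+1])%Z -> offset n j = offset n j'.
Proof.
move=> e; have /level_eqmod E := divz_eqmod e.
rewrite /offset E; case/eqmodzP: e => q ->.
by rewrite HS mulrA -addrA addrC -addrA modzMDl addrC.
Qed.

Lemma enc_eqmod n j j' : (j = j' %[mod H n])%Z -> enc n j = enc n j'.
Proof.
elim: n j j' => [|n IH] j j' e /=; first exact: level_eqmod.
by rewrite (IH _ _ (divz_eqmod e)) (offset_eqmod e).
Qed.

Lemma enc_itv n j : 0 <= enc n j < H n.
Proof.
elim: n j => [|n IH] j; first exact: level_itv.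
have := IH (j %/ K n)%Z; have := transpose_itv (offset_itv n j).
rewrite /= HS; move: (enc _ _) (transpose _ _) => x y; have := H_gt0 n; nia.
Qed.

Lemma dec_itv n v : 0 <= dec n v < H n.
Proof.
elim: n v => [|n IH] v /=; first exact: modz_itv.
rewrite HS; have := IH (v %% H n)%Z.
have := modz_itv (transpose_inv n (v %/ H n)%Z + level n (dec n (v %% H n)%Z)) (K_gt0 n).
move: (dec _ _) (_ %% K n)%Z => x y; have := K_gt0 n; have := H_gt0 n; nia.
Qed.

Lemma encK n j : dec n (enc n j) = (j %% H n)%Z.
Proof.
elim: n j => [|n IH] j /=; first by rewrite level_mulp.
have [q1 q2] := divz_modz_unique (transpose n (offset n j)) (enc_itv n (j %/ K n)%Z).
rewrite [enc n _ + _]addrC [H n * _]mulrC q1 q2 IH transposeK ?offset_itv//.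
rewrite /offset; set a := (j %/ K n)%Z.
have -> : level n (a %% H n)%Z = level n a by apply: level_eqmod; rewrite modz_mod.
rewrite modzDml subrK.
have K0 := K_gt0 n; have jK := modz_itv j K0; have aH := modz_itv a (H_gt0 n).
have b : 0 <= (a %% H n)%Z * K n + (j %% K n)%Z < H n.+1 by rewrite HS; nia.
rewrite -(modz_small b); apply/eqmodzP; exists (- (a %/ H n)%Z).
have E1 := divz_eq j (K n); have E2 := divz_eq a (H n); rewrite -/a in E1.
by rewrite [in RHS]E1 {1}[in RHS]E2 HS; ring.
Qed.

Lemma decK n v : 0 <= v < H n -> enc n (dec n v) = v.
Proof.
elim: n v => [|n IH] v vH /=; first by rewrite -[RHS](level_p vH); apply: level_eqmod; rewrite modz_mod.
have vn := modz_itv v (H_gt0 n).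
set j := dec n _.
have jK := modz_itv (transpose_inv n (v %/ H n)%Z + level n j) (K_gt0 n).
have [q1 q2] := divz_modz_unique j jK.
rewrite q1 IH// /offset q1.
have E : 0 <= (v %/ H n)%Z < K n.
  rewrite divz_ge0// ltz_divLR//; move: vH; rewrite HS => /andP[-> vH] /=.
  by rewrite mulrC.
have T := transpose_inv_itv E.
set r := ((_ + level n j) %% K n)%Z; rewrite -[j * _ + r - _]addrA modzMDl /r modzDml addrK.
by rewrite (modz_small T) transpose_invK// addrC mulrC -divz_eq.
Qed.

Lemma encS_mod n j : (enc n.+1 j %% H n)%Z = enc n (j %/ K n)%Z.
Proof.
by rewrite /= addrC mulrC modzMDl modz_small// enc_itv.
Qed.

Lemma decS_div n v : 0 <= v < H n.+1 -> (dec n.+1 v %/ K n)%Z = dec n (v %% H n)%Z.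
Proof.
move=> vH /=.
set j := dec n _.
have jK := modz_itv (transpose_inv n (v %/ H n)%Z + level n j) (K_gt0 n).
by have [] := divz_modz_unique j jK.
Qed.

(* [f m] and [g m] are the atoms of t and t + s theta. They are related by the
   rational rotation as long as t stays away from the ends of the atoms; the
   integer [w] counts how many times the level wraps around meanwhile. *)
Section Drift.
Variables (f g : nat -> int) (n : nat) (s w : int).
Hypotheses (fS : forall m, (f m.+1 %/ K m)%Z = f m)
  (gS : forall m, (g m.+1 %/ K m)%Z = g m)
  (gE : forall m, (n <= m)%N -> g m = f m + s * p m)
  (f_mid : forall m, (n <= m)%N -> 4 * H n <= (f m.+1 %% K m)%Z < K m - 4 * H n)
  (s_le : `|s| <= 2 * H n) (w_le : `|w| <= 1)
  (s_w : 0 <= level n (f n) + s - w * H n < H n).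

(** By [levelS_mod] the level follows the position inside the parent, which [f_mid] keeps [4 * H n]
    away from both ends; a shift by at most [2 * H n] cannot make it wrap around. *)
Let level_drift m : (n < m)%N -> level m (g m) = level m (f m) + s.
Proof.
case: m => // m nm; rewrite gE ?(ltnW nm)// level_shift modz_small//.
have mid := f_mid nm; have := levelS_mod m (f m.+1).
move=> /eqP; rewrite eqz_mod_dvd => /dvdzP[q E0].
have E : level m.+1 (f m.+1) = ((f m.+1 %/ K m)%Z + q) * K m + (f m.+1 %% K m)%Z.
  by rewrite mulrDl addrAC -divz_eq addrC -E0 subrK.
have := level_itv m.+1 (f m.+1); rewrite HS E.
have := H_gt0 n; have := K_gt0 m; have := H_gt0 m.
move: mid s_le; move: (_ %% _)%Z (_ + q) => r q' mid sH Hm0 K0 Hn0 qr.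
have q0 : 0 <= q' by nia.
have q1 : q' <= H m - 1 by nia.
have q2 : q' * K m <= (H m - 1) * K m by rewrite ler_pM2r.
have q3 : 0 <= q' * K m by rewrite mulr_ge0// ltW.
rewrite mulrBl mul1r in q2; lia.
Qed.

Let level_drift0 : level n (g n) = level n (f n) + s - w * H n.
Proof.
rewrite gE// level_shift; rewrite -[RHS](modz_small s_w).
by apply/eqmodzP; exists w; rewrite subrK.
Qed.

Let offset_drift m : (n < m)%N -> offset m (g m.+1) = offset m (f m.+1).
Proof.
move=> nm; rewrite /offset gS fS level_drift// gE ?(leqW (ltnW nm))// pS.
by apply/eqmodzP; exists (s * p m); ring.
Qed.

(** Stage [n] is the only one where the level may wrap around: modulo [K n] the position grows by
    [s], while the level grows by [s - w * H n]. The margin in [f_mid] turns the congruence into an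
    equality. *)
Let offset_drift0 : offset n (g n.+1) = offset n (f n.+1) + w * H n.
Proof.
have mid := f_mid (leqnn n); have lev := level_itv n (f n).
have H0 := H_gt0 n; have K0 := K_gt0 n.
have E : offset n (f n.+1) = (f n.+1 %% K n)%Z - level n (f n).
  rewrite -(@modz_small (_ - level n (f n)) (K n)); last by lia.
  by rewrite /offset fS modzDml.
rewrite E -(@modz_small (_ - _ + w * H n) (K n)); last by nia.
rewrite /offset gS level_drift0 gE// pS.
apply/eqmodzP; exists (s * p n + (f n.+1 %/ K n)%Z).
rewrite {1}(divz_eq (f n.+1) (K n)); ring.
Qed.

(** Transposition turns the offset change [w * H n] of stage [n] into [w], which weighs [w * H n] in
    the code; all later offsets agree. The difference of codes no longer depends on [m]: it is the
    power of the odometer that realizes the rotation. *)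
Lemma enc_drift m : (n < m)%N ->
  enc m (g m) - enc m (f m) = enc n (g n) - enc n (f n) + w * H n.
Proof.
elim: m => // m IH; rewrite ltnS leq_eqVlt => /orP[/eqP <-|nm] /=; last first.
  by rewrite offset_drift// gS fS opprD addrACA subrr addr0 IH.
rewrite gS fS offset_drift0 transpose_shift.
by rewrite mulrDr; ring.
Qed.

End Drift.

Lemma level_drift_split n j s : `|s| <= H n -> exists w,
  `|w| <= 1 /\ 0 <= level n j + s - w * H n < H n.
Proof.
move=> sH; exists ((level n j + s) %/ H n)%Z; have H0 := H_gt0 n.
have E := divz_eq (level n j + s) (H n); have := modz_itv (level n j + s) H0.
have := level_itv n j; move: E; move: (_ %% _)%Z (_ %/ _)%Z => r w E lev rH.
split; last by lia.
have : - 2 * H n < w * H n < 2 * H n by lia.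
by rewrite !ltr_pM2r//; lia.
Qed.

(** Here the power [c] is prescribed. Decoding the remainder of [enc n j + c] modulo [H n] gives the
    target atom, and the quotient is imposed as the wrap count [w] of the levels, so that both
    corrections add up to [c]. *)
Lemma enc_drift_onto n j c : `|c| <= H n -> exists s w,
  [/\ `|s| <= 2 * H n, `|w| <= 1, 0 <= level n j + s - w * H n < H n &
      enc n (j + s * p n) - enc n j + w * H n = c].
Proof.
move=> cH; have H0 := H_gt0 n; have ei := enc_itv n j; have li := level_itv n j.
have E := divz_eq (enc n j + c) (H n); have ri := modz_itv (enc n j + c) H0.
set w := (_ %/ _)%Z in E; set v := (_ %% _)%Z in E ri.
have w1 : `|w| <= 1.
  have : - 2 * H n < w * H n < 2 * H n by lia.
  by rewrite !ltr_pM2r//; lia.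
have di := level_itv n (dec n v); set a := level n (dec n v) in di.
exists (a + w * H n - level n j), w; split=> //; [|by lia|].
  have : - H n <= w * H n <= H n by nia.
  by lia.
rewrite (_ : enc n _ = v); first by lia.
rewrite -[RHS](decK ri); apply: enc_eqmod; apply: level_inj.
rewrite level_shift -/a -[RHS](modz_small di); apply/eqmodzP; exists w.
by ring.
Qed.

End Encoding.

(** * Residues in the odometer *)

Section OdometerResidues.
Variables (q : nat -> nat) (q_ge2 : forall n, (2 <= q n)%N).
Local Notation Y := (odo_space q_ge2).
Local Notation P := (radix_prod q).
Local Notation q_gt0 := (radix_gt0 q_ge2).

(** Here the first digit is the least significant one, so that the odometer adds 1 modulo [P m];
    [prefix_value] reads the same digits in the opposite order. *)
Fixpoint residue (y : Y) m : nat :=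
  if m is m'.+1 then (residue y m' + y m' * P m')%N else 0%N.

Lemma radix_prod0 : P 0 = 1%N. Proof. by rewrite /radix_prod big_ord0. Qed.

Lemma radix_prod_dvd m n : (m <= n)%N -> (P m %| P n)%N.
Proof.
elim: n => [|n IH]; first by rewrite leqn0 => /eqP ->.
by rewrite leq_eqVlt => /orP[/eqP ->//|/IH h]; rewrite radix_prodS dvdn_mulr.
Qed.

Lemma radix_prod_gt n : (n < P n)%N.
Proof.
elim: n => [|m IH]; first by rewrite radix_prod0.
by rewrite radix_prodS; have := q_ge2 m; nia.
Qed.

Lemma residue_lt y m : (residue y m < P m)%N.
Proof.
elim: m => [|m IH] /=; first by rewrite radix_prod0.
by rewrite radix_prodS; have := ltn_ord (y m); move: IH; nia.
Qed.

Lemma residue_cylinder y y' m : residue y m = residue y' m <-> cylinder m y' y.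
Proof.
elim: m => [|m IH] /=; first by split => // _ i.
have h := residue_lt y m; have h' := residue_lt y' m; split.
  move=> e; have P0 : (0 < P m)%N by exact: radix_prod_gt0.
  have em : y m = y' m.
    apply: val_inj; have := congr1 (fun a => a %/ P m)%N e.
    by rewrite ![(_ + _ * P m)%N]addnC !divnMDl// !divn_small// !addn0.
  move: e; rewrite em => /addIn /IH e i; rewrite ltnS leq_eqVlt => /orP[/eqP ->//|].
  exact: e.
move=> e; rewrite e//; congr (_ + _)%N; apply/IH => i im; apply: e.
exact: ltnW.
Qed.

Lemma residue_mod y m m' : (m <= m')%N -> (residue y m' %% P m = residue y m)%N.
Proof.
elim: m' => [|m' IH]; first by rewrite leqn0 => /eqP ->; rewrite modn_small// residue_lt.
rewrite leq_eqVlt => /orP[/eqP ->|]; first by rewrite modn_small// residue_lt.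
rewrite ltnS => mm' /=; have /dvdnP[c ->] := radix_prod_dvd mm'.
by rewrite mulnA addnC modnMDl; exact: IH.
Qed.

Lemma residue_inj (y y' : Y) (k : nat -> nat) : (forall n, (n <= k n)%N) ->
  (forall n, residue y (k n) = residue y' (k n)) -> y = y'.
Proof.
move=> kn e; apply: odo_eqP => n; congr (nat_of_ord _).
have := e n.+1 => /residue_cylinder; apply; exact: kn.
Qed.

Lemma residue_succ y m : (residue (odo_succ y) m = residue y m + 1 %[mod P m])%N.
Proof.
(* Keeping the outgoing carry gives an exact identity. The summand is [(0 < m)] because the unit
   enters at digit 0, which the empty prefix does not contain. *)
have E : (residue (odo_succ y) m + carry y (odo_one q_ge2) m * P m = residue y m + (0 < m))%N.
  elim: m => [//|m IH] /=; rewrite radix_prodS; set d := (y m + _ + _)%N.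
  rewrite (_ : (_ + _ + _)%N = residue (odo_succ y) m + (d %/ q m * q m + d %% q m) * P m)%N; last by lia.
  rewrite -divn_eq /d mulnDl addnCA IH; case: m {IH d} => [|m] /=; last by lia.
  by rewrite radix_prod0; lia.
case: m E => [|m] E; first by rewrite radix_prod0 !modn1.
by rewrite -E addnC modnMDl.
Qed.

Lemma residue_aut_iter (R : realType) (k : int) y m :
  ((residue (aut_iter (odometer R q_ge2) k y) m)%:Z =
   (residue y m)%:Z + k %[mod (P m)%:Z])%Z.
Proof.
have S1 z : ((residue (odo_succ z) m)%:Z = (residue z m)%:Z + 1 %[mod (P m)%:Z])%Z.
  by have /(congr1 Posz) := residue_succ z m; rewrite -!modz_nat PoszD.
have S2 z : ((residue (odo_pred z) m)%:Z = (residue z m)%:Z - 1 %[mod (P m)%:Z])%Z.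
  have := S1 (odo_pred z); rewrite odo_predK => /eqmodzP[c E].
  by apply/eqmodzP; exists (- c); rewrite E; ring.
case: k => k; elim: k => [|k IH].
- by rewrite addr0.
- rewrite (_ : aut_iter _ _ _ = odo_succ (aut_iter (odometer R q_ge2) k y)) //.
  by rewrite S1 -modzDml IH modzDml intS; congr (_ %% _)%Z; ring.
- by rewrite (_ : aut_iter _ _ _ = odo_pred y) // S2.
rewrite (_ : aut_iter _ _ _ = odo_pred (aut_iter (odometer R q_ge2) (Negz k) y)) //.
by rewrite S2 -modzDml IH modzDml !NegzE [in RHS]intS; congr (_ %% _)%Z; ring.
Qed.

(** Exponents with the same image are congruent modulo every [P m], and [P m > m]. *)
Lemma odometer_free (R : realType) (y : Y) :
  injective (fun k => aut_iter (odometer R q_ge2) k y).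
Proof.
move=> k k' e; have D m : (P m %| `|k - k'|)%N.
  have := congr1 (fun y => (residue y m)%:Z %% (P m)%:Z)%Z e.
  rewrite !residue_aut_iter => /eqP.
  by rewrite eqz_mod_dvd opprD addrACA subrr add0r.
apply/eqP; rewrite -subr_eq0 -absz_eq0 -leqn0 leqNgt; apply/negP => k0.
by have := leq_trans (radix_prod_gt _) (dvdn_leq k0 (D `|k - k'|%N)); rewrite ltnn.
Qed.

(** The odometer space seen as an inverse limit: when [v m.+1 = v m] modulo [P m], this is the point
    with residues [v m]. *)
Definition odo_point (v : nat -> nat) : Y :=
  fun n => Ordinal (ltn_pmod (v n.+1 %/ P n) (q_gt0 n)).

Lemma residue_odo_point (v : nat -> nat) m :
  (forall m, v m.+1 = v m %[mod P m]) -> residue (odo_point v) m = (v m %% P m)%N.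
Proof.
move=> vS; elim: m => [|m IH] /=; first by rewrite radix_prod0 modn1.
rewrite IH -vS radix_prodS [in RHS](divn_eq (v m.+1) (P m)).
rewrite [in RHS](divn_eq (v m.+1 %/ P m) (q m)) mulnDl -mulnA [(q m * _)%N]mulnC -addnA modnMDl.
rewrite [RHS]modn_small 1?addnC//.
have := ltn_pmod (v m.+1 %/ P m) (q_gt0 m).
have := ltn_pmod (v m.+1) (radix_prod_gt0 q_ge2 m).
by move: (_ %% q m)%N (_ %% P m)%N => a b; nia.
Qed.

Lemma measurable_odo1 (y : Y) : measurable [set y].
Proof.
rewrite (_ : [set y] = \bigcap_n cylinder n y).
  by apply: bigcapT_measurable => n; exact: measurable_cylinder.
apply/seteqP; split => [_ -> //|x /= h].
by apply: odo_eqP => n; rewrite (h n.+1).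
Qed.

(** The lengths [k n] are unbounded, so cylinders of these lengths still generate. The class [G]
    also contains [setT], as even the shortest of these cylinders may be proper. *)
Lemma odo_prob_unique (R : realType) (m : {measure set Y -> \bar R}) (k : nat -> nat) :
  (forall n, (n <= k n)%N) -> m setT = 1%E ->
  (forall n a, m (cylinder (k n) a) = ((P (k n))%:R^-1)%:E) ->
  forall A, measurable A -> m A = odo_prob R q_ge2 A.
Proof.
move=> kn m1 mc.
pose G : set (set Y) :=
  [set A | [\/ A = set0, A = setT | exists n a, A = cylinder (k n) a]].
have GI : setI_closed G.
  have sub n m' (a b : Y) : (n <= m')%N ->
      cylinder n a `&` cylinder m' b = set0 \/
      cylinder n a `&` cylinder m' b = cylinder m' b.
    move=> nm; have [ab|nab] := pselect (cylinder n a b); [right|left].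
      apply/seteqP; split=> [x []//|x xb]; split=> // i ilt.
      by rewrite xb ?ab//; exact: leq_trans nm.
    rewrite -subset0 => x [xa xb]; apply: nab => i ilt; rewrite -xa// xb//.
    exact: leq_trans nm.
  move=> A B GA GB; case: (GA) => [->|->|[n [a AE]]]; rewrite ?set0I ?setTI//; first exact: Or31.
  case: (GB) => [->|->|[m' [b BE]]]; rewrite ?setI0 ?setIT//; first exact: Or31.
  rewrite AE BE in GA GB *; case: (leqP (k n) (k m')) => nm.
    by have [->|->] := sub _ _ a b nm => //; exact: Or31.
  by rewrite setIC; have [->|->] := sub _ _ b a (ltnW nm) => //; exact: Or31.
have GE : @measurable _ Y = <<s G >>.
  apply/seteqP; split; last first.
    apply: smallest_sub; first exact: sigma_algebra_measurable.
    by move=> _ [->|->|[n [a ->]]] //; exact: measurable_cylinder.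
  apply: smallest_sub; first exact: smallest_sigma_algebra.
  move=> _ [n [i ->]].
  pose F (s : seq nat) : set Y :=
    if word_point q_ge2 s n == i then cylinder (k n.+1) (word_point q_ge2 s) else set0.
  rewrite (_ : [set x : Y | x n = i] = \bigcup_s F s).
    apply: (@countable_bigcupT_measurable _ (g_sigma_algebraType G)) => [|s].
      exact: countableP.
    apply: sub_sigma_algebra; rewrite /F; case: ifP => _; [apply: Or33|exact: Or31].
    by exists n.+1, (word_point q_ge2 s).
  apply/seteqP; split => [x xk|x [s _]]; rewrite /F.
    have wx : cylinder (k n.+1) x
        (word_point q_ge2 (mkseq (fun i => nat_of_ord (x i)) (k n.+1))).
      by move=> j jlt; apply: val_inj => /=; rewrite nth_mkseq// modn_small.
    exists (mkseq (fun i => nat_of_ord (x i)) (k n.+1)) => //.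
    by rewrite wx// xk eqxx => j jlt; rewrite wx.
  by case: eqP => // sk xs; rewrite /= xs.
apply: (measure_unique G (fun=> setT)) => //.
- by move=> _; exact: Or32.
- by rewrite bigcup_const//; exists 0%N.
- move=> A [->|->|[n [a ->]]]; first by rewrite !measure0.
    by rewrite m1; exact/esym/(@probability_setT _ _ _ (odo_prob R q_ge2)).
  by rewrite mc; exact/esym/odo_prob_cylinder.
- by move=> _; rewrite m1 ltry.
Qed.

End OdometerResidues.

(** * Divisibility in a universal radix and fast growing towers of levels *)

Section UniversalRadix.
Variables (q : nat -> nat) (q_ge2 : forall n, (2 <= q n)%N).
Local Notation P := (radix_prod q).

(** One prime at a time: the valuation of [P k] is a partial sum that universality makes unbounded.
    Only primes up to [m] matter, and the sum of their thresholds is a common threshold. *)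
Lemma universal_dvd m : universal_radix q -> (0 < m)%N ->
  exists k0, forall k, (k0 <= k)%N -> (m %| P k)%N.
Proof.
move=> qu m0.
have logP p k : logn p (P k) = (\sum_(i < k) logn p (q i))%N.
  elim: k => [|k IH]; first by rewrite radix_prod0 big_ord0 logn1.
  by rewrite radix_prodS lognM ?radix_prod_gt0// ?radix_gt0// big_ord_recr/= IH.
have /choice[f Hf] p : exists k, prime p -> (logn p m <= logn p (P k))%N.
  have [pp|np] := boolP (prime p); last by exists 0%N.
  by have [k hk] := qu p pp (logn p m); exists k => _; rewrite logP.
exists (\sum_(p < m.+1) f p)%N => k hk; apply/dvdn_partP => // p.
rewrite mem_primes => /and3P[pp _ pm].
rewrite p_part pfactor_dvdn ?radix_prod_gt0//.
apply: leq_trans (Hf p pp) _.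
apply: dvdn_leq_log; first exact: radix_prod_gt0.
apply: radix_prod_dvd; apply: leq_trans hk.
have pm1 : (p < m.+1)%N by rewrite ltnS dvdn_leq.
by rewrite (bigD1 (Ordinal pm1))//= leq_addr.
Qed.

(** [F] is a growth requirement depending on the stage, level and numerator reached. By universality
    it can be met together with the divisibility by [P (k n) ^ 2], since every large enough level is
    suitable. *)
Lemma tower_sequence (F : nat -> nat -> int -> nat) (k0 : nat) (p0 : int) :
  universal_radix q -> exists (k : nat -> nat) (p : nat -> int),
  [/\ k 0 = k0 /\ p 0 = p0, forall n, (k n < k n.+1)%N,
      forall n, (P (k n) ^ 2 %| P (k n.+1))%N,
      forall n, (F n (k n) (p n) <= P (k n.+1))%N &
      forall n, p n.+1 = p n * (P (k n.+1) %/ P (k n))%:Z + 1].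
Proof.
move=> qu.
have ex (x : nat * nat * int) : exists k', [/\ (x.1.2 < k')%N,
    (P x.1.2 ^ 2 %| P k')%N & (F x.1.1 x.1.2 x.2 <= P k')%N].
  have [|k1 hk1] := @universal_dvd (P x.1.2 ^ 2) qu.
    by rewrite expn_gt0 radix_prod_gt0.
  exists (maxn k1 (maxn x.1.2.+1 (F x.1.1 x.1.2 x.2))); split.
  - by rewrite !leq_max leqnn orbT.
  - by apply: hk1; rewrite leq_max leqnn.
  - by apply: ltnW; apply: leq_ltn_trans (radix_prod_gt q_ge2 _); rewrite !leq_max leqnn !orbT.
have [g Hg] := choice ex.
pose step (x : nat * nat * int) : nat * nat * int :=
  (x.1.1.+1, g x, x.2 * (P (g x) %/ P x.1.2)%:Z + 1).
pose s n := iter n step (0%N, k0, p0).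
have s1 n : (s n).1.1 = n by elim: n => //= n ->.
exists (fun n => (s n).1.2), (fun n => (s n).2); split=> // n /=;
  have := Hg (s n); rewrite -/(s n); rewrite ?s1; by case.
Qed.

End UniversalRadix.

(** * The limit of the rational angles *)

Section Angle.
Variables (R : realType) (H p : nat -> int).
Hypotheses (H_gt0 : forall n, 0 < H n) (H_double : forall n, 2 * H n <= H n.+1)
  (H_dvd : forall n, (H n %| H n.+1)%Z)
  (pS : forall n, p n.+1 = p n * (H n.+1 %/ H n)%Z + 1).

Let alpha n : R := (p n)%:~R / (H n)%:~R.

(** The sequence [alpha] is strictly increasing, while [alpha n + 2 / H n.+1] decreases because [H]
    at least doubles; [theta] is the supremum of the former. *)
Lemma angle_limit : exists theta : R, forall n,
  0 < theta - alpha n <= 2 / (H n.+1)%:~R.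
Proof.
have H0 n : 0 < (H n)%:~R :> R by rewrite ltr0z.
have aS n : alpha n.+1 = alpha n + (H n.+1)%:~R^-1.
  rewrite /alpha pS intrD intrM mulrDl mul1r; congr (_ + _).
  rewrite -mulrA; congr (_ * _); rewrite -{2}(divzK (H_dvd n)) intrM invfM mulrA.
  rewrite divff ?mul1r// intr_eq0.
  by apply/eqP => E; have := divzK (H_dvd n); rewrite E mul0r; have := H_gt0 n.+1; lia.
have a_lt n : alpha n < alpha n.+1 by rewrite aS ltrDl invr_gt0.
have a_le m n : (m <= n)%N -> alpha m <= alpha n.
  elim: n => [|n IH]; first by rewrite leqn0 => /eqP ->.
  rewrite leq_eqVlt => /orP[/eqP ->//|/IH h]; exact: le_trans h (ltW (a_lt n)).
pose b n := alpha n + 2 / (H n.+1)%:~R.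
have b_ge n : b n.+1 <= b n.
  rewrite /b aS -addrA lerD2l.
  suff : (2 : R) / (H n.+2)%:~R <= (H n.+1)%:~R^-1.
    by move: (H n.+1)%:~R^-1 (2 / _) => x y; lra.
  rewrite ler_pdivrMr// -ler_pdivrMl ?invr_gt0// invrK.
  by have := H_double n.+1; rewrite -(ler_int R) intrM mulrC.
have b_le m n : (m <= n)%N -> b n <= b m.
  elim: n => [|n IH]; first by rewrite leqn0 => /eqP ->.
  rewrite leq_eqVlt => /orP[/eqP ->//|/IH h]; exact: le_trans (b_ge n) h.
have ab n : alpha n <= b n by rewrite lerDl divr_ge0// ltW.
have ub n : ubound (range alpha) (b n).
  move=> _ [m _ <-]; case: (leqP m n) => mn.
    exact: le_trans (a_le _ _ mn) (ab n).
  exact: le_trans (ab m) (b_le _ _ (ltnW mn)).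
have hs : has_sup (range alpha) by split; [exists (alpha 0), 0%N|exists (b 0)].
exists (sup (range alpha)) => n; apply/andP; split.
  rewrite subr_gt0; apply: lt_le_trans (a_lt n) _.
  by apply: sup_upper_bound => //; exists n.+1.
rewrite lerBlDl; apply: ge_sup; last exact: ub.
by exists (alpha 0), 0%N.
Qed.

End Angle.

(** * The argument on the circle *)

Section CircleArgument.
Variable R : realType.
Implicit Types (z : circle R) (t : R).

Definition arg z : R :=
  if 0 <= complex.Im (z : R[i]) then acos (complex.Re (z : R[i])) / (2 * pi)
  else 1 - acos (complex.Re (z : R[i])) / (2 * pi).

Lemma circle_unit z :
  complex.Re (z : R[i]) ^+ 2 + complex.Im (z : R[i]) ^+ 2 = 1.
Proof.
case: z => -[a b] /= /eqP; rewrite normc_def /= => -[].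
move=> /(congr1 (fun x => x ^+ 2)); rewrite expr1n sqr_sqrtr//.
by rewrite addr_ge0 ?sqr_ge0.
Qed.

Lemma circle_Re_itv z : -1 <= complex.Re (z : R[i]) <= 1.
Proof. by have := circle_unit z; move: (complex.Re _) (complex.Im _) => a b; nra. Qed.

Let pi2_gt0 : 0 < 2 * pi :> R. Proof. by rewrite mulr_gt0// pi_gt0. Qed.
Let pi2_neq0 : 2 * pi != 0 :> R. Proof. by rewrite gt_eqF. Qed.

Lemma arg_itv z : 0 <= arg z < 1.
Proof.
have zR := circle_Re_itv z; rewrite /arg; case: ifPn => [zI|].
  rewrite divr_ge0 ?acos_ge0 ?(ltW pi2_gt0)//= ltr_pdivrMr// mul1r.
  by rewrite (le_lt_trans (acos_lepi zR))// mulr_natl mulr2n ltrDl pi_gt0.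
rewrite -ltNge => zI; have zR1 : -1 <= complex.Re (z : R[i]) < 1.
  have := circle_unit z; move: zI zR; move: (complex.Re _) (complex.Im _) => a b; nra.
rewrite subr_ge0 ler_pdivrMr// mul1r (le_trans (acos_lepi zR)).
  by rewrite /= ltrBlDr ltrDl divr_gt0 ?acos_gt0.
by rewrite mulr_natl mulr2n lerDl pi_ge0.
Qed.

Lemma expi_arg z : expi (arg z) = z.
Proof.
have zR := circle_Re_itv z; have zu := circle_unit z.
have sE : sin (acos (complex.Re (z : R[i]))) = `|complex.Im (z : R[i])|.
  by rewrite sin_acos// -sqrtr_sqr -zu addrAC subrr add0r.
have cE : cos (acos (complex.Re (z : R[i]))) = complex.Re (z : R[i]).
  by rewrite acosK// in_itv.
have E1 (a : R) : 2 * pi * (a / (2 * pi)) = a by rewrite mulrC divfK.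
have E2 (a : R) : 2 * pi * (1 - a / (2 * pi)) = pi *+ 2 - a.
  by rewrite mulrBr mulr1 E1 mulr_natl.
apply: circle_eqP => /=; rewrite /arg; case: ifPn => zI; rewrite ?E1 ?E2 //.
- by rewrite -[X in cos X]opprB cosN -(cosD2pi (_ - _)) subrK.
- by rewrite sE ger0_norm.
rewrite -[X in sin X]opprB sinN -(sinD2pi (_ - _)) subrK sE ler0_norm ?opprK//.
by rewrite -ltNge in zI; rewrite ltW.
Qed.

Lemma arg_expi t : 0 <= t < 1 -> arg (expi t) = t.
Proof.
move=> t01; rewrite /arg /=; have p0 := @pi_gt0 R.
have [th|th] := leP t 2^-1.
  have h : 0 <= 2 * pi * t <= pi by nra.
  by rewrite sin_ge0_pi// cosK ?in_itv//= mulrC mulKf.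
have h : 0 < pi *+ 2 - 2 * pi * t < pi by rewrite -(mulr_natl pi); nra.
have sE : sin (2 * pi * t) = - sin (pi *+ 2 - 2 * pi * t).
  by rewrite -sinN opprB -(sinD2pi (_ - _)) subrK.
have cE : cos (2 * pi * t) = cos (pi *+ 2 - 2 * pi * t).
  by rewrite -[RHS]cosN opprB -(cosD2pi (_ - _)) subrK.
rewrite sE oppr_ge0 leNgt sin_gt0_pi//= cE cosK ?in_itv/=.
  by rewrite -(mulr_natl pi) mulrBl divff// mulrC mulKf// opprB addrC subrK.
by case/andP: h => /ltW -> /ltW.
Qed.

Lemma arg_expi_floor t : arg (expi t) = t - (Num.floor t)%:~R.
Proof.
rewrite -(@arg_expi (t - _)); last by rewrite subr_ge0 ltrBlDl floor_le/= -[X in _ + X]/(1%:~R) -intrD floorD1_gt.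
by rewrite -mulrNz expi_int.
Qed.

Lemma measurable_arg : measurable_fun [set: circle R] arg.
Proof.
have mI := @measurable_circle_Im R; have mR := @measurable_circle_Re R.
(* Clipping to [[-1, 1]] makes [acos] monotone, hence measurable, on the whole line, and changes
   nothing on the circle. *)
pose a (x : R) := acos (Num.max (-1) (Num.min x 1)).
have ma : measurable_fun [set: R] a.
  apply: nonincreasing_measurable => // x y xy; rewrite /a.
  have clip (s : R) : -1 <= Num.max (-1) (Num.min s 1) <= 1.
    by rewrite le_max lexx/= ge_max ge_min lexx orbT andbT; lra.
  rewrite leNgt -ltr_cos ?in_itv/= ?acos_ge0 ?acos_lepi// !acosK ?in_itv//= -leNgt.
  rewrite ge_max le_max lexx/= le_max; apply/orP; right.
  by rewrite le_min ge_min xy/= ge_min lexx orbT.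
apply: (@eq_measurable_fun _ _ _ _ _ (fun z : circle R =>
    if 0 <= complex.Im (z : R[i]) then a (complex.Re (z : R[i])) / (2 * pi)
    else 1 - a (complex.Re (z : R[i])) / (2 * pi))).
  move=> z _; rewrite /arg /a; have /andP[h1 h2] := circle_Re_itv z.
  by rewrite (min_idPl h2) (max_idPr h1).
apply: measurable_fun_ifT => /=.
- exact: measurable_fun_ler.
- by apply: measurable_funM => //; exact: (measurableT_comp ma mR).
- apply: measurable_funB => //.
  by apply: measurable_funM => //; exact: (measurableT_comp ma mR).
Qed.

Lemma haar_arg (S : set R) : measurable S ->
  haar R (arg @^-1` S) = lebesgue_measure (S `&` `[0, 1[).
Proof.
move=> mS; have mA : measurable (arg @^-1` S).
  by rewrite -[X in measurable X]setTI; exact: measurable_arg.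
rewrite /= /distribution /pushforward uniform_probE; last first.
  by rewrite -[X in measurable X]setTI; exact: measurable_expi.
congr (lebesgue_measure _); apply/seteqP; split => t /=; rewrite in_itv/= => -[h t01];
  by move: h; rewrite arg_expi.
Qed.

Lemma measurable_circle1 z : measurable [set z].
Proof.
rewrite (_ : [set z] = arg @^-1` [set arg z]).
  by rewrite -[X in measurable X]setTI; exact: measurable_arg.
apply/seteqP; split => [w ->//|w /= e].
by rewrite -(expi_arg w) e expi_arg.
Qed.

Lemma haar_set1 z : haar R [set z] = 0%E.
Proof.
rewrite (_ : [set z] = arg @^-1` [set arg z]); last first.
  apply/seteqP; split => [w ->//|w /= e].
  by rewrite -(expi_arg w) e expi_arg.
rewrite haar_arg//; apply: (@subset_measure0 _ _ _ lebesgue_measure _ [set arg z]) => //.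
- exact: measurableI.
- exact: lebesgue_measure_set1.
Qed.

Lemma rotation_aut_iter (theta : R) (k : int) z :
  aut_iter (rotation theta) k z = circle_mul (expi (k%:~R * theta)) z.
Proof.
case: k => k; elim: k => [|k IH] /=.
- by rewrite mul0r expi0 circle_mul1.
- by rewrite /= in IH; rewrite IH circle_mulA -expiD intS intrD mulrDl mul1r.
- by rewrite mulN1r.
- rewrite /= in IH; rewrite IH circle_mulA -expiD -mulN1r -mulrDl.
  by rewrite !NegzE -(intrD _ (-1)); congr (circle_mul (expi (_%:~R * _)) _); lia.
Qed.

(** Comparing arguments makes [(k - k') theta] a difference of two floors, so [theta] would be
    rational. *)
Lemma rotation_free (theta : R) z : irrational theta ->
  injective (fun k => aut_iter (rotation theta) k z).
Proof.
move=> irr k k'; rewrite !rotation_aut_iter => e.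
apply: contrapT => /eqP kk'; apply: irr.
have e1 : expi (k%:~R * theta) = expi (k'%:~R * theta).
  have zV : circle_mul z (expi (- arg z)) = circle1 R.
    by rewrite -{1}(expi_arg z) -expiD subrr expi0.
  have := congr1 (fun w : circle R => circle_mul w (expi (- arg z))) e.
  by rewrite -!circle_mulA zV !(circle_mulC _ (circle1 R)) !circle_mul1.
have := congr1 arg e1; rewrite !arg_expi_floor => /eqP.
rewrite -subr_eq0 => /eqP E0.
have E : (k - k')%:~R * theta = (Num.floor (k%:~R * theta) - Num.floor (k'%:~R * theta))%:~R.
  by rewrite !intrB; move: E0; lra.
have k0 : (k - k')%:~R != 0 :> R by rewrite intr_eq0 subr_eq0.
exists ((Num.floor (k%:~R * theta) - Num.floor (k'%:~R * theta))%:Q / (k - k')%:Q) => //.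
rewrite fmorph_div/= !ratr_int.
by apply: (mulIf k0); rewrite divfK// [RHS]mulrC E.
Qed.

End CircleArgument.

(** * Measure-theoretic tools *)

Section CountableRepair.
Context (X Y : pointedType) (f : X -> Y) (e : nat -> X).
Hypotheses (f_inj : injective f) (e_inj : injective e)
  (f_cofin : countable (~` range f)).

(* Hilbert's hotel: [f] is altered on the range of [e] only, to absorb the
   countably many points that it misses. *)
Lemma countable_repair : exists (F : X -> Y) (G : Y -> X),
  [/\ cancel F G, cancel G F & forall x, ~ range e x -> F x = f x].
Proof.
(* [D] gathers what the range of [e] must now cover: its former images and the missed points. It is
   countably infinite, so [b] enumerates it without repetition and [F] sends [e n] to [b n]. *)
pose D := (f @` range e) `|` ~` range f.
have cD : countable D.
  rewrite /D -bigcup2E; apply: bigcup_countable => // -[|[|i]] _ //=.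
  rewrite (_ : f @` range e = range (f \o e)); last by rewrite image_comp.
  exact: card_image_le.
have iD : infinite_set D.
  apply/infiniteP; apply: (card_le_trans (B := range (f \o e))); last first.
    by apply: subset_card_le => _ [n _ <-]; left; exists (e n) => //; exists n.
  suff /card_eqPle[_ //] : (range (f \o e) #= [set: nat])%card.
  by apply: inj_card_eq => i j _ _ /f_inj /e_inj.
have /card_esym/card_set_bijP[b [bD b_inj b_surj]] := eq_card_nat cD iD.
pose F x := if pselect (exists n, e n = x) is left h then b (sval (cid h)) else f x.
have Fe n : F (e n) = b n.
  rewrite /F; case: pselect => [h|[]]; last by exists n.
  by congr b; apply: e_inj; exact: (svalP (cid h)).
have Fn x : ~ range e x -> F x = f x.
  by rewrite /F => nx; case: pselect => // h; case: nx; case: h => n <-; exists n.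
have bE n : D (b n) by exact: bD.
have F_inj : injective F.
  move=> x x'; have [[n _ <-]|nx] := pselect (range e x);
    have [[n' _ <-]|nx'] := pselect (range e x').
  - by rewrite !Fe => h; congr e; apply: b_inj; rewrite ?inE.
  - rewrite Fe (Fn _ nx') => h; have := bE n; rewrite h => -[[y [m _ <-]]|[]].
      by move=> /f_inj h'; case: nx'; exists m.
    by exists x'.
  - rewrite Fe (Fn _ nx) => h; have := bE n'; rewrite -h => -[[y [m _ <-]]|[]].
      by move=> /f_inj h'; case: nx; exists m.
    by exists x.
  - by rewrite !Fn// => /f_inj.
have F_surj y : exists x, F x = y.
  have [Dy|nDy] := pselect (D y).
    by have [n _ <-] := b_surj _ Dy; exists (e n).
  have [[x _ xy]|ny] := pselect (range f y); last by case: nDy; right.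
  by exists x; rewrite Fn// => -[n _ nx]; case: nDy; left; exists x => //; exists n.
have [G FG] := choice F_surj.
by exists F, G; split=> // x; apply: F_inj; rewrite FG.
Qed.

End CountableRepair.

Section IsoModCountable.
Context d d' (X : measurableType d) (Y : measurableType d') (R : realType).
Variables (mu : probability X R) (nu : probability Y R).
Variables (f : X -> Y) (g : Y -> X) (e : nat -> X).
Hypotheses (mf : measurable_fun setT f) (mg : measurable_fun setT g)
  (fK : cancel f g) (e_inj : injective e) (f_cofin : countable (~` range f))
  (mX : forall x : X, measurable [set x]) (mY : forall y : Y, measurable [set y])
  (muX : forall x : X, mu [set x] = 0%E)
  (f_push : forall A, measurable A -> mu (f @^-1` A) = nu A).

Lemma countable_measure0 (A : set X) : countable A -> mu A = 0%E.
Proof.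
move=> /countable_injP[h h_inj].
pose B n := A `&` h @^-1` [set n].
have mB n : measurable (B n).
  have [->//|/set0P[x [Ax hx]]] := eqVneq (B n) set0.
  rewrite (_ : B n = [set x])//; apply/seteqP; split => [y [Ay hy]|y ->//].
  by apply: h_inj; rewrite ?inE// hx hy.
have B0 n : mu (B n) = 0%E.
  have [->|/set0P[x [Ax hx]]] := eqVneq (B n) set0; first exact: measure0.
  rewrite (_ : B n = [set x])//; apply/seteqP; split => [y [Ay hy]|y ->//].
  by apply: h_inj; rewrite ?inE// hx hy.
rewrite (_ : A = \bigcup_n B n); last first.
  by apply/seteqP; split => [x Ax|x [n _ []//]]; exists (h x).
apply: measure_negligible; first exact: bigcupT_measurable.
by apply: negligible_bigcup => n; exact: (negligibleP mu (mB n)).2 (B0 n).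
Qed.


(** The altered points form a countable, hence measurable and null, set. Off it [F] is [f], and off
    its image [G] is [g]. *)
Lemma mp_iso_mod_countable : exists (Psi : mp_iso mu nu),
  forall x, ~ range e x -> Psi x = f x.
Proof.
have [F [G [FG GF Fe]]] := countable_repair (can_inj fK) e_inj f_cofin.
pose N := range e; have cN : countable N by exact: card_image_le.
have mN : measurable N by exact: countable_measurable.
have cFN : countable [set F x | x in N].
  by apply: sub_countable cN; exact: card_image_le.
have FpE A : F @^-1` A = ((f @^-1` A) `\` N) `|` ((F @^-1` A) `&` N).
  apply/seteqP; split => x /=.
    by move=> FA; have [Nx|nNx] := pselect (N x); [right|left; rewrite -Fe].
  by case=> [[fA nN]|[]//]; rewrite Fe.
have cI (U : Type) (A B : set U) : countable B -> countable (A `&` B).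
  by apply: sub_countable; apply: subset_card_le; by move=> y [].
have mfp A : measurable A -> measurable (f @^-1` A).
  by move=> mA; rewrite -[X in measurable X]setTI; exact: mf.
have mF : measurable_fun setT F.
  move=> _ A mA; rewrite setTI FpE; apply: measurableU.
    by apply: measurableD => //; exact: mfp.
  by apply: countable_measurable => //; exact: cI.
have mG : measurable_fun setT G.
  move=> _ A mA; rewrite setTI.
  have -> : G @^-1` A = ((g @^-1` A) `\` [set F x | x in N]) `|` ((G @^-1` A) `&` [set F x | x in N]).
    have GgE y : ~ [set F x | x in N] y -> G y = g y.
      move=> ny; have nG : ~ N (G y) by move=> NG; apply: ny; exists (G y).
      by rewrite -{2}(GF y) Fe// fK.
    apply/seteqP; split => y /=.
      by move=> GA; have [Ny|nNy] := pselect ([set F x | x in N] y); [right|left; rewrite -GgE].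
    by case=> [[fA nN]|[]//]; rewrite GgE.
  apply: measurableU.
    apply: measurableD; last exact: countable_measurable.
    by rewrite -[X in measurable X]setTI; exact: mg.
  by apply: countable_measurable => //; exact: cI.
have push A : measurable A -> pushforward mu F A = nu A.
  move=> mA; rewrite /pushforward -f_push// FpE.
  have N0 : mu N = 0%E by exact: countable_measure0.
  have m1 := mfp _ mA.
  rewrite measureU; last 3 first.
  - exact: measurableD.
  - by apply: countable_measurable => //; exact: cI.
  - by rewrite -subset0 => x [[_ +] [_]].
  rewrite [X in (_ + X)%E]countable_measure0 ?adde0; last exact: cI.
  rewrite measureD//=; last by rewrite ltey_eq fin_num_measure.
  by rewrite [X in (_ - X)%E]countable_measure0 ?sube0//; exact: cI.
by exists (MPIso FG GF mF mG push).
Qed.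

End IsoModCountable.

(** Off [N], [f] is at most the series of the [w n] times the indicators of [B n], whose integrals
    are summable by comparison with a geometric series. *)
Lemma integral_lty_layers d (T : measurableType d) (R : realType)
    (mu : {measure set T -> \bar R}) (f : T -> R) (N : set T)
    (B : nat -> set T) (w : nat -> R) (C : R) :
  (forall x, 0 <= f x) -> measurable N -> mu N = 0%E ->
  (forall n, measurable (B n)) -> (forall n, 0 <= w n) -> 0 <= C ->
  (forall n, ((w n)%:E * mu (B n) <= (C / (2 ^ n.+1)%:R)%:E)%E) ->
  (forall x, ~ N x -> exists2 n, B n x & f x <= w n) ->
  (\int[mu]_x (f x)%:E < +oo)%E.
Proof.
move=> f0 mN N0 mB w0 C0 wB fB.
(* The indicator of [N] makes the series infinite on [N], where nothing bounds [f], at no cost for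
   the integral. *)
pose h n x := (w n * \1_(B n) x + \1_N x)%:E.
have h0 n x : (0 <= h n x)%E by rewrite lee_fin addr_ge0// mulr_ge0.
have mh n : measurable_fun setT (h n).
  apply/measurable_EFinP; apply: measurable_funD => //.
  by apply: measurable_funM.
have fh x : ((f x)%:E <= \sum_(n <oo) h n x)%E.
  have [Nx|/fB[n Bnx fw]] := pselect (N x).
    apply: (@le_trans _ _ (\sum_(0 <= n < (Num.truncn (f x)).+1) h n x)%E); last first.
      by apply: nneseries_lim_ge => n _ _; exact: h0.
    rewrite sumEFin/= lee_fin.
    rewrite (le_trans (ltW (truncnS_gt _)))// -[X in X%:R]subn0 -[X in X <= _]mulr1.
    rewrite mulr_natl -sumr_const_nat; apply: ler_sum_nat => i _.
    by rewrite !indicE (mem_set Nx) lerDr mulr_ge0.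
  apply: (@le_trans _ _ (h n x)).
    by rewrite lee_fin (le_trans fw)// !indicE (mem_set Bnx) mulr1 lerDl.
  apply: (@le_trans _ _ (\sum_(0 <= n < n.+1) h n x)%E); last first.
    by apply: nneseries_lim_ge => k _ _; exact: h0.
  by rewrite big_nat_recr//= leeDr// sume_ge0.
(* [f] may fail to be measurable, but the integral of a nonnegative function is
   a supremum over the simple functions below it, hence monotone. *)
have mono : (\int[mu]_x (f x)%:E <= \int[mu]_x (\sum_(n <oo) h n x))%E.
  rewrite !ge0_integralTE//; last by move=> x; exact: nneseries_ge0.
  apply: le_ereal_sup => _ [g gf <-]; exists g => // x.
  exact: le_trans (gf x) (fh x).
apply: le_lt_trans mono _; rewrite integral_nneseries//.
apply: (@le_lt_trans _ _ (\sum_(n <oo) (C / (2 ^ n.+1)%:R)%:E)%E); last first.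
  by apply: le_lt_trans (epsilon_trick0 _ C0) _; rewrite ltry.
apply: lee_nneseries => [n _ _|n _]; first by apply: integral_ge0.
rewrite /h.
under eq_integral do rewrite EFinD.
rewrite ge0_integralD//; last 3 first.
- by move=> x _; rewrite lee_fin mulr_ge0.
- by apply/measurable_EFinP; apply: measurable_funM.
- by apply/measurable_EFinP.
rewrite integral_indic// setIT N0 adde0.
under eq_integral do rewrite EFinM.
rewrite ge0_integralZl_EFin//; last by apply/measurable_EFinP.
by rewrite integral_indic// setIT.
Qed.

(** * The orbit equivalence *)

Section Coding.
Variables (R : realType) (q : nat -> nat) (q_ge2 : forall n, (2 <= q n)%N).
Variables (k : nat -> nat) (H K M p u : nat -> int) (theta : R).
Local Notation P := (radix_prod q).
Local Notation Y := (odo_space q_ge2).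
Local Notation T := (odometer R q_ge2).
Hypotheses (k_incr : forall n, (k n < k n.+1)%N)
  (HE : forall n, H n = (P (k n))%:Z) (M_ge : forall n, n.+2%:Z <= M n)
  (KE : forall n, K n = H n * M n) (HS : forall n, H n.+1 = H n * K n)
  (pS : forall n, p n.+1 = p n * K n + 1)
  (puE : forall n, (u n * p n = 1 %[mod H n])%Z)
  (theta_itv : forall n,
     0 < theta - (p n)%:~R / (H n)%:~R <= 2 / (H n.+1)%:~R).
Implicit Types (t : R) (z : circle R) (y : Y) (n m : nat) (s c : int).

Let H_gt0 n : 0 < H n. Proof. by rewrite HE ltz_nat radix_prod_gt0. Qed.
Let M_gt0 n : 0 < M n. Proof. exact: lt_le_trans (M_ge n). Qed.
Let K_gt0 n : 0 < K n. Proof. by rewrite KE mulr_gt0. Qed.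
Let HR_gt0 n : 0 < (H n)%:~R :> R. Proof. by rewrite ltr0z. Qed.
Let KR_gt0 n : 0 < (K n)%:~R :> R. Proof. by rewrite ltr0z. Qed.

Lemma k_ge n : (n <= k n)%N.
Proof. by elim: n => // n IH; exact: leq_ltn_trans IH (k_incr n). Qed.

Lemma k_mono n m : (n <= m)%N -> (k n <= k m)%N.
Proof.
elim: m => [|m IH]; first by rewrite leqn0 => /eqP ->.
by rewrite leq_eqVlt => /orP[/eqP ->//|/IH h]; exact: leq_trans h (ltnW (k_incr m)).
Qed.

(** * Atoms of the circle and their drift under the rotation *)

Definition atom n t : int := Num.floor (t * (H n)%:~R).

Lemma atom_div n t : (atom n.+1 t %/ K n)%Z = atom n t.
Proof.
apply/esym/floor_def; have K0 := K_gt0 n.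
have /andP[lo hi] := floor_itv (t * (H n.+1)%:~R); rewrite -/(atom n.+1 t) in lo hi.
have E : t * (H n.+1)%:~R = t * (H n)%:~R * (K n)%:~R by rewrite HS intrM mulrA.
rewrite E in lo hi.
apply/andP; split.
  rewrite -(ler_pM2r (KR_gt0 n)); apply: le_trans lo.
  by rewrite -intrM ler_int lez_floor// gt_eqF.
rewrite -(ltr_pM2r (KR_gt0 n)); apply: lt_le_trans hi _.
by rewrite -intrM ler_int; have := ltz_ceil (atom n.+1 t) K0; lia.
Qed.

Lemma atom_int n t c : atom n (t + c%:~R) = atom n t + c * H n.
Proof.
rewrite /atom mulrDl -intrM floorDrz ?intr_int//.
by congr (_ + _); exact: intrKfloor.
Qed.

(* All the translates of [t] by at most [2 * H n] times [theta] stay in atoms that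
   are predicted by the rational rotations of index at least [n]. *)
Definition good n t := forall m, (n <= m)%N ->
  4 * H n <= (atom m.+1 t %% K m)%Z < K m - 4 * H n.

(** As [theta] is within [2 / H m.+1] of [p m / H m], the translations by [s] times each differ by
    at most [4 * H n] atoms of level [m.+1], the margin that [good] leaves inside the atom of level
    [m]. *)
Lemma atom_drift n t s m : good n t -> `|s| <= 2 * H n -> (n <= m)%N ->
  atom m (t + s%:~R * theta) = atom m t + s * p m.
Proof.
move=> gt sH nm; apply: floor_def; have K0 := KR_gt0 m.
have /andP[l1 l2] := gt m nm.
have /andP[lo hi] := floor_itv (t * (H m.+1)%:~R); rewrite -/(atom m.+1 t) in lo hi.
have aE := divz_eq (atom m.+1 t) (K m); rewrite atom_div in aE.
have E : t * (H m.+1)%:~R = t * (H m)%:~R * (K m)%:~R by rewrite HS intrM mulrA.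
rewrite E {}aE in lo hi; set l := (_ %% _)%Z in l1 l2 lo hi; clearbody l.
have /andP[d0 d1] := theta_itv m; set d := theta - _ in d0 d1.
have thE : theta * (H m)%:~R = (p m)%:~R + d * (H m)%:~R.
  by rewrite /d mulrBl divfK ?gt_eqF// addrC subrK.
have dK : d * (H m)%:~R * (K m)%:~R <= 2.
  by rewrite -mulrA -intrM -HS -ler_pdivlMr.
have dK0 : 0 <= d * (H m)%:~R * (K m)%:~R by rewrite !mulr_ge0// ltW.
pose e : R := s%:~R * (d * (H m)%:~R) * (K m)%:~R.
have eH : - (4 * H n)%:~R <= e <= (4 * H n)%:~R.
  have sR : `|s%:~R| <= (2 * H n)%:~R :> R by rewrite -intr_norm ler_int.
  rewrite -ler_norml /e -mulrA normrM (ger0_norm dK0).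
  have -> : 4 * H n = 2 * H n * 2 by ring.
  by rewrite intrM; apply: ler_pM.
have -> : (t + s%:~R * theta) * (H m)%:~R =
    t * (H m)%:~R + (s * p m)%:~R + e / (K m)%:~R.
  by rewrite /e mulfK ?gt_eqF// mulrDl -mulrA thE intrM; ring.
have L1 : (4 * H n)%:~R <= l%:~R :> R by rewrite ler_int.
have L2 : l%:~R + 1 <= (K m)%:~R - (4 * H n)%:~R :> R.
  by rewrite -[X in _ + X]/(1%:~R) -intrD -intrB ler_int; lia.
rewrite !intrD !intrM in lo hi.
move: eH lo hi L1 L2; rewrite /=; set X := t * _; set F : R := (atom m t)%:~R.
set k' : R := (K m)%:~R; set c := (4 * H n)%:~R => /andP[e1 e2] lo hi L1 L2.
have ek : e / k' * k' = e by rewrite divfK// gt_eqF.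
have A1 : F <= X + e / k' by rewrite -(ler_pM2r K0) mulrDl ek -/k'; lra.
have A2 : X + e / k' < F + 1 by rewrite -(ltr_pM2r K0) !mulrDl ek mul1r -/k'; lra.
by rewrite !intrD -/F; move: A1 A2; move: (e / k') => ? A1 A2; apply/andP; split; lra.
Qed.

(** * The coding map from the circle to the odometer *)

Definition code n t : int := enc H K M u n (atom n t).

Lemma code_itv n t : 0 <= code n t < H n.
Proof. exact: enc_itv. Qed.

Lemma code_mod n m t : (n <= m)%N -> (code m t %% H n)%Z = code n t.
Proof.
elim: m => [|m IH]; first by rewrite leqn0 => /eqP ->; rewrite modz_small// code_itv.
rewrite leq_eqVlt => /orP[/eqP ->|nm]; first by rewrite modz_small// code_itv.
have e : (code m.+1 t %% H m)%Z = code m t by rewrite /code encS_mod// atom_div.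
rewrite -IH// -e; apply/eqmodzP.
have /dvdzP[c E] : (H n %| H m)%Z by rewrite !HE dvdzE/= radix_prod_dvd// k_mono.
exists ((code m.+1 t %/ H m)%Z * c).
by rewrite -mulrA -E addrC -divz_eq.
Qed.

Lemma code_int n t c : code n (t + c%:~R) = code n t.
Proof.
by rewrite /code atom_int; apply: enc_eqmod => //; apply/eqmodzP; exists c.
Qed.

Lemma code_arg n t : code n (arg (expi t)) = code n t.
Proof. by rewrite arg_expi_floor -mulrNz code_int. Qed.

(** The codes are coherent by [code_mod], and [odo_point] needs them modulo [P n] only, which
    divides [H n] because [n <= k n]. *)
Definition psi z : Y := odo_point q_ge2 (fun n => `|code n (arg z)|%N).

Lemma residue_psi z n : (residue (psi z) (k n))%:Z = code n (arg z).
Proof.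
have absE m : `|code m (arg z)|%N%:Z = code m (arg z).
  by have /andP[c0 _] := code_itv m (arg z); rewrite gez0_abs.
rewrite residue_odo_point => [|m].
  by rewrite -modz_nat absE -HE code_mod// k_ge.
apply/eqP; rewrite -eqz_nat -!modz_nat !absE; apply/eqP.
have /eqmodzP[c E] : (code m.+1 (arg z) = code m (arg z) %[mod H m])%Z.
  by rewrite code_mod// modz_small// code_itv.
have /dvdzP[c' E'] : ((P m)%:Z %| H m)%Z by rewrite HE dvdzE/= radix_prod_dvd// k_ge.
by apply/eqmodzP; exists (c * c'); rewrite E E' mulrA.
Qed.

Lemma psi_iter t t' c n :
  (forall m, (n < m)%N -> code m t' = code m t + c) ->
  aut_iter T c (psi (expi t)) = psi (expi t').
Proof.
move=> cd; apply: (@residue_inj _ _ _ _ (fun j => k (n + j).+1)) => j.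
  by apply: leq_trans (k_ge _); rewrite ltnW// ltnS leq_addl.
set m := (n + j).+1; apply/eqP; rewrite -eqz_nat; apply/eqP.
rewrite -[LHS](@modz_small _ (H m)); last by rewrite HE ltz_nat residue_lt.
rewrite HE residue_aut_iter residue_psi code_arg -cd ?ltnS ?leq_addr//.
by rewrite residue_psi code_arg -HE modz_small// code_itv.
Qed.

(** The power [c] is the change of code at stage [n] plus the wrap term [w * H n], each at most
    [H n] in absolute value. *)
Lemma psi_fwd t n s : good n t -> `|s| <= H n -> exists2 c, `|c| <= 2 * H n &
  aut_iter T c (psi (expi t)) = psi (expi (t + s%:~R * theta)).
Proof.
move=> gt sH; have s2H : `|s| <= 2 * H n by have := H_gt0 n; lia.
have [w [w1 sw]] := level_drift_split u H_gt0 (atom n t) sH.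
set t' := t + _.
have drift m : (n < m)%N -> code m t' = code m t + (code n t' - code n t + w * H n).
  move=> nm; have := @enc_drift H K M p u H_gt0 M_gt0 KE HS pS puE
    (fun m => atom m t) (fun m => atom m t') n s w (fun m => atom_div m t)
    (fun m => atom_div m t') (fun m nm => atom_drift gt s2H nm) gt s2H w1 sw m nm.
  by rewrite /code; lia.
exists (code n t' - code n t + w * H n); last exact: psi_iter drift.
have := code_itv n t; have := code_itv n t'.
have : - H n <= w * H n <= H n by have := H_gt0 n; nia.
lia.
Qed.

Lemma psi_bwd t n c : good n t -> `|c| <= H n -> exists2 s, `|s| <= 2 * H n &
  aut_iter T c (psi (expi t)) = psi (expi (t + s%:~R * theta)).
Proof.
move=> gt cH.
have [s [w [s2H w1 sw sc]]] := @enc_drift_onto H K M p u H_gt0 M_gt0 KE HS puE n (atom n t) c cH.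
exists s => //; apply: (@psi_iter _ _ _ n) => m nm.
set t' := t + _.
have := @enc_drift H K M p u H_gt0 M_gt0 KE HS pS puE
  (fun m => atom m t) (fun m => atom m t') n s w (fun m => atom_div m t)
  (fun m => atom_div m t') (fun m nm => atom_drift gt s2H nm) gt s2H w1 sw m nm.
by rewrite /code -sc (atom_drift gt s2H (leqnn n)); lia.
Qed.

(** * The inverse of the coding map *)

Definition cell n y : int := dec H K M p u n (residue y (k n))%:Z.

Let residue_itv n y : 0 <= (residue y (k n))%:Z < H n.
Proof. by rewrite HE ltz_nat residue_lt. Qed.

Lemma cell_itv n y : 0 <= cell n y < H n.
Proof. exact: dec_itv. Qed.

Lemma cell_div n y : (cell n.+1 y %/ K n)%Z = cell n y.
Proof.
rewrite /cell decS_div// HE modz_nat residue_mod// ltnW//.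
Qed.

Lemma enc_cell n y : enc H K M u n (cell n y) = (residue y (k n))%:Z.
Proof. exact: decK. Qed.

Lemma cell_inj y y' n : (forall m, (n <= m)%N -> cell m y = cell m y') -> y = y'.
Proof.
move=> e; apply: (@residue_inj _ _ _ _ (fun j => k (n + j)%N)) => j.
  by apply: leq_trans (k_ge _); rewrite leq_addl.
by apply/eqP; rewrite -eqz_nat -!enc_cell e// leq_addr.
Qed.

Lemma atom_itv n t : 0 <= t < 1 -> 0 <= atom n t < H n.
Proof.
move=> /andP[t0 t1]; rewrite floor_ge0 floor_lt_int mulr_ge0 ?(ltW (HR_gt0 n))//=.
by rewrite gtr_pMl.
Qed.

Lemma cell_psi n z : cell n (psi z) = atom n (arg z).
Proof.
rewrite /cell residue_psi /code encK// modz_small//.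
by apply: atom_itv; exact: arg_itv.
Qed.

Definition lo n y : R := (cell n y)%:~R / (H n)%:~R.
Definition hi n y : R := (cell n y + 1)%:~R / (H n)%:~R.

Let lo_step n y : lo n y <= lo n.+1 y.
Proof.
rewrite /lo ler_pdivrMr// mulrAC ler_pdivlMr// -!intrM ler_int HS.
by have := lez_floor (cell n.+1 y) (lt0r_neq0 (K_gt0 n)); rewrite cell_div; have := H_gt0 n; nia.
Qed.

Let hi_step n y : hi n.+1 y <= hi n y.
Proof.
rewrite /hi ler_pdivrMr// mulrAC ler_pdivlMr// -!intrM ler_int HS.
by have := ltz_ceil (cell n.+1 y) (K_gt0 n); rewrite cell_div; have := H_gt0 n; nia.
Qed.

Lemma lo_homo y n m : (n <= m)%N -> lo n y <= lo m y.
Proof. by apply/nondecreasing_seqP: n m => n; exact: lo_step. Qed.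

Lemma hi_homo y n m : (n <= m)%N -> hi m y <= hi n y.
Proof. by apply/nonincreasing_seqP: n m => n; exact: hi_step. Qed.

Lemma lo_hi n m y : lo n y <= hi m y.
Proof.
apply: (@le_trans _ _ (lo (maxn n m) y)); first by apply: lo_homo; rewrite leq_maxl.
apply: (@le_trans _ _ (hi (maxn n m) y)); last by apply: hi_homo; rewrite leq_maxr.
by rewrite /lo /hi ler_pM2r ?invr_gt0// ler_int lerDl.
Qed.

(** The common point of the nested closed intervals [[lo n y, hi n y]]; it may be one of their right
    ends, which half-open atoms exclude. *)
Definition angle y : R := sup (range (lo ^~ y)).

Lemma point_cvg y : lo n y @[n --> \oo] --> angle y.
Proof.
apply: nondecreasing_cvgn; first exact: lo_homo.
by exists (hi 0 y) => _ [n _ <-]; exact: lo_hi.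
Qed.

Lemma point_itv n y : lo n y <= angle y <= hi n y.
Proof.
apply/andP; split.
  apply: sup_upper_bound; last by exists n.
  split; first by exists (lo n y), n.
  by exists (hi 0 y) => _ [m _ <-]; exact: lo_hi.
apply: ge_sup; first by exists (lo n y), n.
by move=> _ [m _ <-]; exact: lo_hi.
Qed.

Definition psi_inv y : circle R := expi (angle y).

Lemma atom_bounds n t : (atom n t)%:~R / (H n)%:~R <= t < (atom n t + 1)%:~R / (H n)%:~R.
Proof. by rewrite ler_pdivrMr// ltr_pdivlMr// floor_itv. Qed.

Lemma H_gt n : n%:~R < (H n)%:~R :> R.
Proof. by rewrite ltr_int HE ltz_nat (leq_ltn_trans (k_ge n))// radix_prod_gt. Qed.

(** The angle of [psi z] and the argument of [z] lie in the same closed interval of length [1 / H n]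
    for every [n]. *)
Lemma psiK : cancel psi psi_inv.
Proof.
move=> z; rewrite /psi_inv -[RHS]expi_arg; congr expi.
have close n : `|angle (psi z) - arg z| * (H n)%:~R <= 1.
  have /andP[p1 p2] := point_itv n (psi z); have /andP[a1 a2] := atom_bounds n (arg z).
  rewrite /lo /hi cell_psi in p1 p2.
  rewrite !intrD !mulrDl mul1r in p2 a2; rewrite -ler_pdivlMr// mul1r ler_norml.
  by apply/andP; split; lra.
apply/eqP; rewrite -subr_eq0 -normr_le0 leNgt; apply/negP => d0.
set D := `|_| in close d0; have D1 := truncnS_gt D^-1.
have := lt_trans D1 (H_gt (Num.truncn D^-1).+1).
by rewrite -(ltr_pM2l d0) divff ?gt_eqF// ltNge close.
Qed.

(** * Measurability, image measure and missed points of the coding map *)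

Lemma measurable_atom n (B : int -> Prop) :
  measurable [set z : circle R | B (atom n (arg z))].
Proof.
pose F (j : int) : set (circle R) :=
  if `[< B j >] then @arg R @^-1` `[j%:~R / (H n)%:~R, (j + 1)%:~R / (H n)%:~R[ else set0.
rewrite (_ : mkset _ = \bigcup_j F j).
  apply: countable_bigcupT_measurable => [|j]; first exact: countableP.
  rewrite /F; case: ifP => _ //; rewrite -[X in measurable X]setTI.
  by apply: measurable_arg => //; exact: measurable_itv.
apply/seteqP; split => [z /= Bz|z [j _]]; rewrite /F.
  exists (atom n (arg z)) => //; rewrite asboolT//= in_itv/=.
  exact: atom_bounds.
case: asboolP => // Bj; rewrite /= in_itv/= ler_pdivrMr// ltr_pdivlMr// => h.
by rewrite /atom (floor_def h).
Qed.

Lemma measurable_psi : measurable_fun [set: circle R] psi.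
Proof.
apply: measurable_to_odo => n i.
exact: (measurable_atom n.+1
  (fun j => Ordinal (ltn_pmod (`|enc H K M u n.+1 j|%N %/ P n) (radix_gt0 q_ge2 n)) = i)).
Qed.

Lemma haar_atom n (j : int) : 0 <= j < H n ->
  haar R [set z | atom n (arg z) = j] = ((H n)%:~R^-1)%:E.
Proof.
move=> /andP[j0 jH].
pose I : set R := `[j%:~R / (H n)%:~R, (j + 1)%:~R / (H n)%:~R[%classic.
rewrite (_ : [set z | _] = @arg R @^-1` I); last first.
  apply/seteqP; split => z /=; rewrite /I /= in_itv/=; first by move=> <-; exact: atom_bounds.
  by rewrite ler_pdivrMr// ltr_pdivlMr// => h; exact: floor_def.
rewrite haar_arg; last exact: measurable_itv.
rewrite (_ : I `&` _ = I).
  rewrite lebesgue_measure_itv/= lte_fin ltr_pM2r ?invr_gt0// ltr_int ltrDl ltr01.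
  by rewrite -EFinB -mulrBl intrD addrAC subrr add0r mul1r.
apply/seteqP; split => [t []//|t It]; split => //; move: It; rewrite /I /= !in_itv/=.
move=> /andP[h1 h2]; apply/andP; split.
  by apply: le_trans h1; rewrite divr_ge0// ?ler0z// ltW.
by apply: lt_le_trans h2 _; rewrite ler_pdivrMr// mul1r ler_int; lia.
Qed.

(** The preimage of a cylinder of length [k n] is one atom of level [n]; both have mass
    [1 / H n]. *)
Lemma psi_push (A : set Y) : measurable A -> haar R (psi @^-1` A) = odo_prob R q_ge2 A.
Proof.
move=> mA; pose m0 : {measure set Y -> \bar R} := pushforward (haar R) psi.
pose m := m0 measurable_psi.
apply: (@odo_prob_unique _ _ _ m k) => //; first exact: k_ge.
  by rewrite /m /m0/= /pushforward preimage_setT; exact: probability_setT.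
move=> n a; rewrite /m /m0 /= /pushforward.
rewrite (_ : psi @^-1` _ = [set z | atom n (arg z) = cell n a]).
  by rewrite haar_atom ?cell_itv// HE.
apply/seteqP; split => z /=.
  by move=> /residue_cylinder h; rewrite -cell_psi /cell h.
rewrite -cell_psi => h; apply/residue_cylinder; apply/eqP.
by rewrite -eqz_nat -!enc_cell h.
Qed.

(** Each [lo n] depends on finitely many digits, and [angle] is the pointwise limit. *)
Lemma measurable_psi_inv : measurable_fun [set: Y] psi_inv.
Proof.
apply: (measurableT_comp (@measurable_expi R)).
apply: (@measurable_fun_cvg _ _ _ _ lo) => [n|y _]; last exact: point_cvg.
move=> _ A mA; rewrite setTI; apply: (@measurable_local _ _ (k n)) => y y' yy'.
rewrite /= /lo /cell (_ : residue y (k n) = residue y' (k n))//.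
by apply/esym/residue_cylinder.
Qed.

(** A missed point has its angle at the right end of one of its cells. It then stays at the right
    end of all later cells, so that [n] and [cell n y] determine [y]. *)
Lemma psi_cofinite : countable (~` range psi).
Proof.
pose A (x : nat * int) : set Y :=
  [set y | cell x.1 y = x.2 /\ angle y = hi x.1 y].
apply: (@sub_countable _ _ _ (\bigcup_x A x)); last first.
  apply: bigcup_countable => [|[n j] _]; first exact: countableP.
  have [->//|/set0P[y [/= yj yp]]] := eqVneq (A (n, j)) set0.
  rewrite (_ : A (n, j) = [set y]); first exact: countable1.
  apply/seteqP; split => [y' [/= yj' yp']|_ ->//].
  have pyy' : angle y' = angle y by rewrite yp yp' /hi yj yj'.
  apply: (@cell_inj _ _ n) => m nm.
  have E x : angle x = hi n x -> (cell m x + 1)%:~R = angle x * (H m)%:~R.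
    move=> xp; have : angle x = hi m x.
      apply/eqP; rewrite eq_le; have /andP[_ ->] := point_itv m x.
      by rewrite xp hi_homo.
    by rewrite /hi => ->; rewrite divfK// gt_eqF.
  have := E _ yp; rewrite -pyy' -(E _ yp') => /eqP.
  by rewrite eqr_int => /eqP /addIr.
apply: subset_card_le => y ny; apply: contrapT => nA; apply: ny.
have lt_hi n : angle y < hi n y.
  have /andP[_] := point_itv n y; rewrite le_eqVlt => /orP[/eqP e|//].
  by case: nA; exists (n, cell n y).
have aE n : atom n (angle y) = cell n y.
  apply: floor_def; have /andP[h _] := point_itv n y; have := lt_hi n.
  by move: h; rewrite /lo /hi ler_pdivrMr// ltr_pdivlMr// => -> ->.
have p01 : 0 <= angle y < 1.
  have := cell_itv 0 y; rewrite -aE; rewrite floor_ge0 floor_lt_int.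
  by rewrite pmulr_lge0// gtr_pMl.
exists (expi (angle y)) => //; apply: (@cell_inj _ _ 0) => m _.
by rewrite cell_psi arg_expi.
Qed.

(** * Measure of the bad sets *)

Definition arc n (x c : int) : set (circle R) :=
  @arg R @^-1` [set` `[(x%:~R / (H n)%:~R : R), (x + c)%:~R / (H n)%:~R[ ].

Let measurable_arc n x c : measurable (arc n x c).
Proof. by rewrite -[X in measurable X]setTI; apply: measurable_arg => //; exact: measurable_itv. Qed.

Let haar_arc_le n (x c : int) : 0 <= c ->
  (haar R (arc n x c) <=
   (c%:~R / (H n)%:~R)%:E)%E.
Proof.
move=> c0; rewrite haar_arg; last exact: measurable_itv.
apply: (@le_trans _ _ (lebesgue_measure [set` `[(x%:~R / (H n)%:~R : R), (x + c)%:~R / (H n)%:~R[ ])).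
  by apply: le_measure; rewrite ?inE; [exact: measurableI|exact: measurable_itv|exact: subIsetl].
rewrite lebesgue_measure_itv/=; case: ifP => _.
  by rewrite -EFinB -mulrBl intrD addrAC subrr add0r.
by rewrite lee_fin divr_ge0// ?ler0z// ltW.
Qed.

Definition edge m (c : int) : set (circle R) :=
  [set z | ~ (c <= (atom m.+1 (arg z) %% K m)%Z < K m - c)].

Lemma measurable_edge m c : measurable (edge m c).
Proof. exact: (measurable_atom m.+1 (fun j => ~ (c <= (j %% K m)%Z < K m - c))). Qed.

(** Each of the [H m] atoms of level [m] loses at most [c] atoms of level [m.+1] at either end, out
    of [K m]. *)
Lemma haar_edge_le m c : 0 <= c ->
  (haar R (edge m c) <=
   ((2 * c)%:~R / (K m)%:~R)%:E)%E.
Proof.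
move=> c0.
pose F (h : nat) := arc m.+1 (h%:Z * K m) c `|` arc m.+1 (h%:Z * K m + K m - c) c.
have mF h : measurable (F h) by apply: measurableU; exact: measurable_arc.
have haarF h : (haar R (F h) <= ((2 * c)%:~R / (H m.+1)%:~R)%:E)%E.
  apply: (le_trans (measureU2 _ _ _)) => //; try exact: measurable_arc.
  rewrite mulr_natl mulr2n intrD mulrDl EFinD; apply: leeD; exact: haar_arc_le.
apply: le_trans (_ : (\sum_(h < `|H m|%N) haar R (F h) <= _)%E).
  apply: content_subadditive => [h _||] //; first exact: measurable_edge.
  move=> z /= zE; rewrite -bigcup_mkord.
  have t01 := arg_itv z; have /andP[h0 hH] := atom_itv m t01.
  have aE := divz_eq (atom m.+1 (arg z)) (K m); rewrite atom_div in aE.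
  have /andP[l0 lK] := modz_itv (atom m.+1 (arg z)) (K_gt0 m).
  exists `|atom m (arg z)|%N => /=; first by rewrite -ltz_nat !gez0_abs// ltW.
  have /andP[lo' hi'] := floor_itv (arg z * (H m.+1)%:~R).
  rewrite -/(atom m.+1 (arg z)) in lo' hi'.
  have inarc x : x <= atom m.+1 (arg z) -> atom m.+1 (arg z) + 1 <= x + c -> arc m.+1 x c z.
    move=> x1 x2; rewrite /arc/= in_itv/= ler_pdivrMr// ltr_pdivlMr//; apply/andP; split.
      by apply: le_trans lo'; rewrite ler_int.
    by apply: lt_le_trans hi' _; rewrite ler_int.
  rewrite /F gez0_abs//.
  move: zE aE l0 lK; rewrite /edge/=; move: (_ %% _)%Z (_ * K m) => l hK zE aE l0 lK.
  have [lc|lc] := ltP l c; [left|right]; apply: inarc; rewrite aE; first by lia.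
  - by lia.
  - by move/negP: zE; lia.
  - by lia.
apply: le_trans (_ : (\sum_(h < `|H m|%N) ((2 * c)%:~R / (H m.+1)%:~R)%:E <= _)%E).
  exact: lee_sum.
rewrite sumEFin lee_fin sumr_const card_ord HS -[X in X <= _]mulr_natr.
have -> : (`|H m|%N)%:R = (H m)%:~R :> R by rewrite -[in RHS](@gez0_abs (H m))// ltW.
by rewrite [(H m * _)%:~R]intrM invfM mulrA mulrAC divfK// gt_eqF.
Qed.

Definition bad n : set (circle R) := [set z | ~ good n (arg z)].

Lemma bad_edge n : bad n = \bigcup_i edge (n + i) (4 * H n).
Proof.
apply/seteqP; split => z /= h.
  apply: contrapT => ne; apply: h => m nm; apply: contrapT => he; apply: ne.
  by exists (m - n)%N => //; rewrite subnKC.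
by case: h => i _ he gz; apply: he; apply: gz; exact: leq_addr.
Qed.

Lemma measurable_bad n : measurable (bad n).
Proof. by rewrite bad_edge; apply: bigcupT_measurable => i; exact: measurable_edge. Qed.

Let K_growth n i : K n * (2 ^ i)%N%:Z <= K (n + i)%N.
Proof.
have aux (a b c d : int) : a <= b -> 0 < b -> 0 < c -> 2 <= d -> a * 2 <= c * b * d.
  move=> ab b0 c0 d2; have h1 : b <= c * b by nia.
  have h2 : c * b * 2 <= c * b * d by apply: ler_wpM2l; lia.
  by lia.
elim: i => [|i IH]; first by rewrite addn0 mulr1.
rewrite addnS expnS mulnC PoszM mulrA (KE (n + i).+1) HS; apply: aux => //.
by have := M_ge (n + i).+1; lia.
Qed.

(** The edges have measure at most [8 * H n / K (n + i)], and [K] at least doubles at each stage: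
    the sum is at most [16 * H n / K n]. *)
Lemma haar_bad_le n : (haar R (bad n) <= (16 / (M n)%:~R)%:E)%E.
Proof.
apply: (@le_trans _ _ (\sum_(i <oo) haar R (edge (n + i) (4 * H n)))%E).
  apply: measure_sigma_subadditive; first by move=> i; exact: measurable_edge.
    exact: measurable_bad.
  by rewrite bad_edge.
have M0 : 0 < (M n)%:~R :> R by rewrite ltr0z.
apply: le_trans (@epsilon_trick0 R (16 / (M n)%:~R) xpredT _); last first.
  by rewrite divr_ge0// ltW.
apply: lee_nneseries => [i _ _|i _]; first exact: measure_ge0.
apply: (le_trans (haar_edge_le _ _)); first by have := H_gt0 n; lia.
rewrite lee_fin ler_pdivrMr// mulrAC ler_pdivlMr ?ltr0n ?expn_gt0// mulrAC ler_pdivlMr//.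
rewrite -[(2 ^ _)%:R]/((2 ^ i.+1)%N%:Z%:~R) -[16]/(16%:~R) -!intrM ler_int.
rewrite expnS PoszM; have := K_growth n i; rewrite KE; lia.
Qed.

(** As [M n] tends to infinity, [haar_bad_le] leaves no mass. Almost every point is therefore good
    at arbitrarily large stages. *)
Lemma haar_eventually_bad n0 : haar R (\bigcap_(n in [set n | (n0 <= n)%N]) bad n) = 0%E.
Proof.
set B := \bigcap_(_ in _) _.
have mB : measurable B by apply: bigcap_measurableType => n _; exact: measurable_bad.
have small n : (n0 <= n)%N -> (haar R B <= (16 / (M n)%:~R)%:E)%E.
  move=> nn; apply: le_trans (haar_bad_le n).
  by apply: le_measure; rewrite ?inE//; [exact: measurable_bad|exact: bigcap_inf].
apply/eqP; rewrite eq_le measure_ge0 andbT; apply/lee_addgt0Pr => e e0.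
rewrite add0e; set n := maxn n0 (Num.truncn (16 / e)).
apply: le_trans (small n _) _; first by rewrite leq_maxl.
rewrite lee_fin ler_pdivrMr ?ltr0z// mulrC -ler_pdivrMr//.
apply: le_trans (ltW (truncnS_gt _)) _.
rewrite -[_%:R]/((Num.truncn (16 / e)).+1%:Z%:~R) ler_int.
apply: le_trans (M_ge n); rewrite lez_nat ltnS leqW//.
by rewrite leq_maxr.
Qed.

(** * Orbit equivalence and integrability of the cocycles *)

Section Equivalence.
Variables (phi : R -> R) (w : nat -> R) (C : R).
Hypotheses (theta_irr : irrational theta) (phi_ge0 : forall t, 0 <= t -> 0 <= phi t)
  (w_phi : forall n (j : int), `|j| <= 2 * H n -> phi `|j|%:~R <= w n)
  (w0_le : w 0 <= C / 2)
  (wS_le : forall n, w n.+1 * (16 / (M n)%:~R) <= C / (2 ^ n.+2)%:R).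

Local Notation S := (rotation theta).

(** An arbitrary sequence of distinct points, on which [psi] is altered to become onto. *)
Let base (i : nat) : circle R := expi (i.+2%:R^-1).

Let base_inj : injective base.
Proof.
move=> i j /(congr1 (@arg R)); rewrite !arg_expi => [/invr_inj/eqP||].
- by rewrite eqr_nat => /eqP [].
- by rewrite invr_ge0 ler0n invf_lt1 ?ltr1n ?ltr0n.
- by rewrite invr_ge0 ler0n invf_lt1 ?ltr1n ?ltr0n.
Qed.

Let w_ge0 n : 0 <= w n.
Proof.
apply: le_trans (w_phi (n := n) (j := 0) _); first by rewrite normr0 phi_ge0.
by have := H_gt0 n; lia.
Qed.

Let rotE s z : aut_iter S s z = expi (arg z + s%:~R * theta).
Proof. by rewrite rotation_aut_iter expiD expi_arg circle_mulC. Qed.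

Lemma rotation_odometer_oe : integrably_orbit_equivalent S T phi.
Proof.
split.
- by apply: aeW => z s s0 e; move/eqP: s0; apply; exact: (@rotation_free R theta z theta_irr s 0 e).
- by apply: aeW => y s s0 e; move/eqP: s0; apply; exact: (@odometer_free q q_ge2 R y s 0 e).
have [Psi PsiE] := mp_iso_mod_countable measurable_psi measurable_psi_inv psiK
  base_inj psi_cofinite (@measurable_circle1 R) (@measurable_odo1 _ q_ge2)
  (@haar_set1 R) psi_push.
(* Off [N0], [Psi] and [psi] agree along the whole orbit; the rest of [N] consists of the points bad
   at all large stages. *)
pose N0 : set (circle R) := [set z | exists s, range base (aut_iter S s z)].
have cN0 : countable N0.
  apply: (@sub_countable _ _ _ (\bigcup_s
      ((fun z => circle_mul (expi (- (s%:~R * theta))) z) @` range base))).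
    apply: subset_card_le => z [s [i _ e]]; exists s => //; exists (base i); first by exists i.
    by rewrite e rotation_aut_iter rotationK.
  apply: bigcup_countable => [|s _]; first exact: countableP.
  by rewrite image_comp; exact: card_image_le.
pose N := N0 `|` \bigcup_n0 \bigcap_(n in [set n | (n0 <= n)%N]) bad n.
have mB n0 : measurable (\bigcap_(n in [set n | (n0 <= n)%N]) bad n).
  by apply: bigcap_measurableType => n _; exact: measurable_bad.
have mN0 : measurable N0 by apply: countable_measurable cN0; exact: measurable_circle1.
have mN : measurable N by apply: measurableU => //; exact: bigcupT_measurable.
have N_null : haar R N = 0%E.
  apply: measure_negligible => //; apply: negligibleU.
    by apply/negligibleP => //; apply: countable_measure0 cN0;
       [exact: measurable_circle1|exact: haar_set1].
  apply: negligible_bigcup => n0; apply/negligibleP => //.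
  exact: haar_eventually_bad.
have PsiS z s : ~ N0 z -> Psi (aut_iter S s z) = psi (aut_iter S s z).
  by move=> nz; apply: PsiE => h; apply: nz; exists s.
have Psi0 z : ~ N0 z -> Psi z = psi z by move=> /(PsiS z 0).
have fwd z n s : ~ N0 z -> good n (arg z) -> `|s| <= H n -> exists2 c,
    `|c| <= 2 * H n & aut_iter T c (Psi z) = Psi (aut_iter S s z).
  move=> nz gz sH; have [c cH cE] := psi_fwd gz sH; exists c => //.
  by rewrite Psi0// PsiS// rotE -cE expi_arg.
have bwd z n c : ~ N0 z -> good n (arg z) -> `|c| <= H n -> exists2 s,
    `|s| <= 2 * H n & aut_iter T c (Psi z) = Psi (aut_iter S s z).
  move=> nz gz cH; have [s sH sE] := psi_bwd gz cH; exists s => //.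
  by rewrite Psi0// PsiS// rotE -sE expi_arg.
have NN0 z : ~ N z -> ~ N0 z by move=> nz h; apply: nz; left.
(* Such a point is good at some stage [n] beyond [|c|], and [n < H n]. *)
have far z (c : int) : ~ N z -> exists2 n, good n (arg z) & `|c| <= H n.
  move=> nz; apply: contrapT => h; apply: nz; right.
  exists `|c|%N => // n /= cn gz; apply: h; exists n => //.
  apply: (@le_trans _ _ n%:Z); first by rewrite -lez_nat abszE in cn.
  by rewrite HE lez_nat ltnW// (leq_ltn_trans (k_ge n))// radix_prod_gt.
(* By freeness of the odometer the cocycle is the power given by [fwd] for one step; the default
   value 0 meets the bound trivially. *)
have src z n : ~ N0 z -> good n (arg z) -> `|cocycle_source S T Psi z| <= 2 * H n.
  move=> nz gz; rewrite /cocycle_source; case: xgetP => [c _ /= hc|_]; last first.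
    by rewrite normr0 mulr_ge0// ltW.
  have [|c' c'H c'E] := fwd z n 1 nz gz; first by have := H_gt0 n; lia.
  suff -> : c = c' by [].
  apply: (@odometer_free q q_ge2 R (Psi z)).
  by rewrite c'E -[LHS](mp_invK Psi) -hc.
have tgt y n : ~ N0 (mp_inv Psi y) -> good n (arg (mp_inv Psi y)) ->
    `|cocycle_target S T Psi y| <= 2 * H n.
  move=> nz gz; rewrite /cocycle_target; case: xgetP => [c _ /= hc|_]; last first.
    by rewrite normr0 mulr_ge0// ltW.
  have [|c' c'H c'E] := bwd _ n 1 nz gz; first by have := H_gt0 n; lia.
  suff -> : c = c' by [].
  apply: (@rotation_free R theta (mp_inv Psi y) theta_irr).
  by apply: (can_inj (mp_funK Psi)); rewrite -hc -c'E /= mp_invK.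
(* The layer of a point is its first good stage. The shift by one records that the preceding stage
   was bad, so that [w n.+1] is weighted by the measure of [bad n]. *)
pose B n : set (circle R) := if n is n'.+1 then bad n' else setT.
have mBn n : measurable (B n) by case: n => [|n]; [exact: measurableT|exact: measurable_bad].
have layer z : ~ N z -> exists2 n, B n z & good n (arg z).
  move=> nz; have [n gn _] := far z 0 nz.
  have ex : exists n, `[< good n (arg z) >] by exists n; exact/asboolP.
  have := ex_minnP ex => -[[|m] /asboolP gm mmin]; first by exists 0%N.
  by exists m.+1 => // gm'; have := mmin m; rewrite asboolT// ltnn => /(_ isT).
have C_ge0 : 0 <= C by have := le_trans (w_ge0 0) w0_le; rewrite pmulr_lge0.
have wB n : ((w n)%:E * haar R (B n) <= (C / (2 ^ n.+1)%:R)%:E)%E.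
  case: n => [|n]; first by rewrite /B probability_setT mule1 lee_fin expn1.
  apply: (@le_trans _ _ ((w n.+1)%:E * (16 / (M n)%:~R)%:E)%E).
    by apply: lee_wpmul2l; rewrite ?lee_fin//; exact: haar_bad_le.
  by rewrite -EFinM lee_fin.
exists Psi; split.
- exists N; split=> // z /= hz; apply: contrapT => nz; apply: hz.
  apply/seteqP; split => _ [s _ <-].
    have [n gz sH] := far z s nz; have [c _ cE] := fwd z n s (NN0 _ nz) gz sH.
    by exists c => //; rewrite cE mp_funK.
  have [n gz sH] := far z s nz; have [c _ cE] := bwd z n s (NN0 _ nz) gz sH.
  by exists c => //; rewrite cE mp_funK.
- apply: (@integral_lty_layers _ _ _ _ _ N B w C) => //.
    by move=> z; rewrite phi_ge0// ler0z.
  move=> z nz; have [n Bn gz] := layer z nz; exists n => //.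
  by apply: w_phi; apply: src => //; exact: NN0.
(* The same layers, carried to the odometer by [Psi], keep their measures and control the target
   cocycle. *)
- have inv_push A : measurable A -> odo_prob R q_ge2 (mp_inv Psi @^-1` A) = haar R A.
    move=> mA; rewrite -(mp_push Psi); last first.
      by rewrite -[X in measurable X]setTI; exact: (measurable_mp_inv Psi).
    rewrite /pushforward; congr (haar R _).
    by apply/seteqP; split => z /=; rewrite mp_funK.
  have m_inv A : measurable A -> measurable (mp_inv Psi @^-1` A).
    by move=> mA; rewrite -[X in measurable X]setTI; exact: (measurable_mp_inv Psi).
  apply: (@integral_lty_layers _ _ _ _ _ (mp_inv Psi @^-1` N)
    (fun n => mp_inv Psi @^-1` B n) w C) => //.
  + by move=> y; rewrite phi_ge0// ler0z.
  + exact: m_inv.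
  + by rewrite -N_null; exact: inv_push.
  + by move=> n; exact: m_inv.
  + by move=> n; rewrite [X in (_ * X)%E](inv_push (B n)).
  + move=> y nz; have [n Bn gz] := layer _ nz; exists n => //.
    by apply: w_phi; apply: tgt => //; exact: NN0.
Qed.

End Equivalence.

End Coding.

(** * Choice of the angle *)

(** Cocycles take integer values: the finitely many values of [phi] below the threshold go into [C],
    and beyond it the cube root is at most the identity. *)
Lemma littleo_cuberoot_sublinear (R : realType) (phi : R -> R) :
  (forall t : R, 0 <= t -> 0 <= phi t) ->
  phi =o_ (FilterType (pinfty_nbhs R) _) (fun t => t `^ 3^-1) ->
  forall e : R, 0 < e -> exists2 C : R, 0 <= C & forall j : nat, phi j%:R <= C + e * j%:R.
Proof.
move=> phi_ge0 phi_o e e0.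
move/eqoP: phi_o => /(_ e e0) [N [_ HN]].
pose m := (Num.truncn `|N|).+1.
exists (\sum_(j < m) phi j%:R); first by apply: sumr_ge0 => j _; exact: phi_ge0.
move=> j; have S0 : 0 <= \sum_(j < m) phi j%:R :> R.
  by apply: sumr_ge0 => i _; exact: phi_ge0.
have [jm|mj] := ltnP j m.
  rewrite (bigD1 (Ordinal jm))//= -addrA lerDl addr_ge0//.
    by apply: sumr_ge0 => i _; exact: phi_ge0.
  by rewrite mulr_ge0// ltW.
have jN : N < j%:R.
  apply: le_lt_trans (ler_norm _) _; apply: lt_le_trans (truncnS_gt _) _.
  by rewrite ler_nat.
have := HN _ jN; rewrite /= !ger0_norm ?powR_ge0 ?phi_ge0// => h.
apply: (le_trans h); apply: (@le_trans _ _ (e * j%:R)); last by rewrite lerDr.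
rewrite ler_pM2l//; have j1 : 1 <= j%:R :> R by rewrite ler1n (leq_trans _ mj).
by rewrite -[leRHS]powRr1//; apply: ler_powR => //; lra.
Qed.

(** What the next level [H'] must satisfy: [theta] stays within the gap [d], the ratios tend to
    infinity, and the weights are summable. *)
Lemma growth_threshold (R : realType) (phi : R -> R) (n H : nat) (d : R) :
  (forall e : R, 0 < e -> exists2 C : R, 0 <= C & forall j : nat, phi j%:R <= C + e * j%:R) ->
  (0 < H)%N -> 0 < d -> exists F : nat, forall H' : nat, (F <= H')%N -> (H ^ 2 %| H')%N ->
    [/\ 2 / H'%:R < d, (n.+2 <= H' %/ H ^ 2)%N &
        forall j : nat, (j <= 2 * H')%N ->
          phi j%:R * (16 * 2 ^ n.+2)%:R <= (H' %/ H ^ 2)%:R].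
Proof.
move=> sub H0 d0; pose L : R := (16 * 2 ^ n.+2)%:R; pose h : R := (H ^ 2)%:R.
have L0 : 0 < L by rewrite ltr0n muln_gt0 expn_gt0.
have h0 : 0 < h by rewrite ltr0n expn_gt0 H0.
(* For [j <= 2 M h] this slope contributes at most [M / 2] after multiplication by [L]; the constant
   [C] contributes the other half once [M >= 2 C L]. *)
have [|C C0 hC] := sub ((4 * L * h)^-1); first by rewrite invr_gt0 !mulr_gt0.
exists ((Num.truncn (2 / d)).+1 + H ^ 2 * (n.+2 + (Num.truncn (2 * C * L)).+1))%N.
move=> H' FH' /dvdnP[M ME]; have hh : (0 < H ^ 2)%N by rewrite expn_gt0 H0.
rewrite ME mulnK//.
have Mge : (n.+2 + (Num.truncn (2 * C * L)).+1 <= M)%N.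
  rewrite -(leq_pmul2l hh) [(_ * M)%N]mulnC -ME; apply: leq_trans FH'.
  exact: leq_addl.
have CM : 2 * C * L <= M%:R.
  apply: le_trans (ltW (truncnS_gt _)) _; rewrite ler_nat.
  by apply: leq_trans Mge; exact: leq_addl.
split.
- rewrite -ME; have H'0 : 0 < H'%:R :> R by rewrite ltr0n (leq_trans _ FH').
  rewrite ltr_pdivrMr// mulrC -ltr_pdivrMr//; apply: lt_le_trans (truncnS_gt _) _.
  by rewrite ler_nat; apply: leq_trans FH'; exact: leq_addr.
- by apply: leq_trans Mge; exact: leq_addr.
move=> j jH'; have jR : j%:R <= 2 * M%:R * h.
  by rewrite -mulrA -!natrM ler_nat.
have -> : (16 * 2 ^ n.+2)%:R = L by [].
clearbody L h.
have E : (4 * L * h)^-1 * j%:R * L <= M%:R / 2.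
  have -> : (4 * L * h)^-1 * j%:R * L = j%:R / h / 4.
    by field; rewrite ?gt_eqF.
  have : j%:R / h <= 2 * M%:R by rewrite ler_pdivrMr.
  by move: (_ / h) => x; lra.
have := ler_wpM2r (ltW L0) (hC j); rewrite mulrDl; move: CM E.
by move: (_^-1) => e; lra.
Qed.

Lemma countable_enum (T : Type) (A : set T) (a : T) : countable A ->
  exists c : nat -> T, forall x, A x -> exists n, c n = x.
Proof.
move=> /countable_injP[f f_inj].
have ex n : exists x, forall y, A y -> f y = n -> x = y.
  have [[x [Ax fx]]|nx] := pselect (exists x, A x /\ f x = n).
    by exists x => y Ay fy; apply: f_inj; rewrite ?inE// fx.
  by exists a => y Ay fy; case: nx; exists y.
have [c hc] := choice ex.
by exists c => x Ax; exists (f x); exact: hc.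
Qed.

Theorem theorem4 (R : realType)
    (q : nat -> nat) (q_ge2 : forall n, (2 <= q n)%N)
    (q_universal : universal_radix q)
    (phi : R -> R) (phi_ge0 : forall t : R, 0 <= t -> 0 <= phi t)
    (phi_o : phi =o_ (FilterType (pinfty_nbhs R) _) (fun t => t `^ 3^-1))
    (V : set R) (V_open : open V) (V_neq0 : V !=set0) :
  ~ countable [set theta : R |
      [/\ irrational theta, V theta &
          integrably_orbit_equivalent (rotation theta) (odometer R q_ge2) phi]].
Proof.
set A := [set theta | _] => cA.
have sub := littleo_cuberoot_sublinear phi_ge0 phi_o.
have [v0 Vv0] := V_neq0.
have /nbhs_ballP[r /= r0 rV] : nbhs v0 V by exact: open_nbhs_nbhs.
(* Avoiding the rationals along with [A] yields irrationality by the same device. *)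
have cQ : countable (A `|` @rational R).
  rewrite -bigcup2E; apply: bigcup_countable => // -[|[|i]] _ //=.
  apply: (@sub_countable _ _ _ [set: rat]); last exact: countableP.
  exact: card_image_le.
have [c hc] := countable_enum 0 cQ.
pose P := radix_prod q; have P_gt0 n : (0 < P n)%N by exact: radix_prod_gt0.
pose al (k : nat) (p : int) : R := p%:~R / (P k)%:R.
(* Avoiding [c n] at stage [n] keeps [theta] out of the countable set. *)
pose gap n k p : R := if al k p < c n then Num.min (r / 2) (c n - al k p) else r / 2.
have gap_gt0 n k p : 0 < gap n k p.
  rewrite /gap; case: ifP => h; last by rewrite divr_gt0.
  by rewrite lt_min divr_gt0//= subr_gt0.
have /choice[F hF] (x : nat * nat * int) := growth_threshold x.1.1 sub (P_gt0 x.1.2) (gap_gt0 x.1.1 x.1.2 x.2).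
(* Then [1 / P k0 < r / 2], so the first approximation is within [r / 2] of [v0], and the first gap
   keeps [theta] in the ball. *)
pose k0 := (Num.truncn (2 / r)).+1.
have [k [p [[kk0 pp0] k_incr k_dvd kF pS]]] := tower_sequence q_ge2 (fun n k p => F (n, k, p))
  k0 (Num.floor (v0 * (P k0)%:R)) q_universal.
have hFn n := hF (n, k n, p n) (P (k n.+1)) (kF n) (k_dvd n).
pose H n : int := (P (k n))%:Z.
pose M n : int := (P (k n.+1) %/ P (k n) ^ 2)%:Z.
pose K n : int := H n * M n.
have H_gt0 n : 0 < H n by rewrite ltz_nat.
have HS n : H n.+1 = H n * K n.
  by rewrite /K mulrA /H /M -!PoszM mulnn mulnC divnK.
have KE n : (P (k n.+1) %/ P (k n))%:Z = K n.
  rewrite /K /H /M -PoszM; congr Posz; have /dvdnP[e E] := k_dvd n.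
  by rewrite /P E mulnK ?expn_gt0 ?P_gt0// -mulnn mulnA mulnK ?P_gt0// mulnC.
have M_ge n : n.+2%:Z <= M n by rewrite lez_nat; have [] := hFn n.
have [theta th_itv] : exists theta : R, forall n,
    0 < theta - (p n)%:~R / (H n)%:~R <= 2 / (H n.+1)%:~R.
  apply: angle_limit => // n.
  - by rewrite HS /K; have := M_ge n; have := H_gt0 n; nia.
  - by rewrite HS dvdz_mulr.
  - by rewrite pS divz_nat.
have gapE n : theta - al (k n) (p n) < gap n (k n) (p n).
  have [h _ _] := hFn n; apply: le_lt_trans h.
  by have /andP[_] := th_itv n.
have th_gt n : al (k n) (p n) < theta.
  by have /andP[+ _] := th_itv n; rewrite subr_gt0.
have thV : V theta.
  have r0' : (0 < r :> R)%R by [].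
  suff D : `|v0 - theta| < r by apply: rV; rewrite -ball_normE.
  rewrite ltr_norml; have PR0 : 0 < (P k0)%:R :> R by rewrite ltr0n.
  have g0 : theta - al (k 0) (p 0) < r / 2.
    apply: lt_le_trans (gapE 0) _; rewrite /gap; case: ifP => // _.
    by rewrite ge_min lexx.
  have := th_gt 0; move: g0; rewrite /al pp0 kk0.
  have /andP[f1 f2] := floor_itv (v0 * (P k0)%:R).
  rewrite -ler_pdivrMr// in f1; rewrite intrD -ltr_pdivlMr// mulrDl mul1r in f2.
  have : (P k0)%:R^-1 < r / 2.
    rewrite -[ltRHS]invrK ltf_pV2 ?posrE// ?invr_gt0 ?divr_gt0// invf_div.
    by apply: lt_trans (truncnS_gt _) _; rewrite ltr_nat radix_prod_gt.
  move: f1 f2; have aux (x y : R) : x <= v0 -> v0 < x + y -> y < r / 2 -> theta - x < r / 2 ->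
      x < theta -> - r < v0 - theta < r.
    by move: r0' => {}r0 *; apply/andP; split; lra.
  exact: aux.
(* If [theta] were [c n], the gap at stage [n] would be at most [theta - al (k n) (p n)], against
   [gapE]. *)
have th_notin : ~ (A `|` @rational R) theta.
  move=> /hc[n cn]; have := gapE n; rewrite /gap cn th_gt.
  by rewrite lt_min ltxx andbF.
have th_irr : irrational theta by move=> h; apply: th_notin; right.
apply: th_notin; left; split => //.
(* (1 - pK) (1 + pK) = 1 - p^2 K^2, and H K divides K^2. *)
pose u n : int := 1 - p n * K n.
have puE n : (u n * p n.+1 = 1 %[mod H n.+1])%Z.
  apply/eqmodzP; exists (- p n * p n * M n).
  by rewrite /u pS KE HS /K; ring.
pose w0 : R := \sum_(j < (2 * P (k 1)).+1) phi j%:R.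
have w0_ge0 : 0 <= w0 by apply: sumr_ge0 => j _; exact: phi_ge0.
(* This is the bound of [growth_threshold] at stage [n'.+1], valid up to [2 * H n'.+2]. *)
pose w n : R := if n is n'.+1 then (M n'.+1)%:~R / (16 * 2 ^ n'.+3)%:R else w0.
(* All sequences start at index 1: [p 0] is a floor that may share factors with [H 0], while
   [p n.+1] is invertible modulo [H n.+1]. The constant [2 * w0 + 1] dominates both [2 * w0] and the
   [1 / 2] required at the later stages. *)
apply: (@rotation_odometer_oe R q q_ge2 (fun n => k n.+1) (fun n => H n.+1)
  (fun n => K n.+1) (fun n => M n.+1) (fun n => p n.+1) u theta _ _ _ _ _ _ _ _ phi w (2 * w0 + 1)) => //.
- by move=> n; apply: le_trans (M_ge n.+1); rewrite lez_nat.
- by move=> n; rewrite pS KE.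
- move=> n j; rewrite -abszE -[`|j|%N%:~R]/(`|j|%N%:R) /H -PoszM lez_nat.
  move: `|j|%N => a; case: n => [|n] aH /=.
    rewrite /w0 (bigD1 (Ordinal (aH : (a < (2 * P (k 1)).+1)%N)))//= lerDl.
    by apply: sumr_ge0 => i _; exact: phi_ge0.
  have [_ _ /(_ a aH)] := hFn n.+1.
  by rewrite ler_pdivlMr// ltr0n muln_gt0 expn_gt0.
- by rewrite /=; lra.
move=> n; rewrite /w; have MR0 : 0 < (M n.+1)%:~R :> R.
  by rewrite ltr0z; have := M_ge n.+1; lia.
have e0 : 0 < (2 ^ n.+2)%:R :> R by rewrite ltr0n expn_gt0.
have -> : (16 * 2 ^ n.+3)%:R = 32 * (2 ^ n.+2)%:R :> R by rewrite expnS mulnA natrM.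
move: ((2 ^ n.+2)%:R) e0 (_%:~R) MR0 => e e0 m m0.
have -> : m / (32 * e) * (16 / m) = 2^-1 / e by field; rewrite ?gt_eqF.
by rewrite ler_pM2r ?invr_gt0//; lra.
Qed.
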